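(* Let $\lambda=\mu>0$ and $N\in\mathbb N$. Let $$P(x)=x\left[\prod_{r=0}^{N-1}\bigl(x+2\mu(2r+1)\bigr)+\prod_{r=0}^{N-1}\bigl(x+2\mu(2r+2)\bigr)\right],\qquad Q(x)=\prod_{r=0}^{N-1}\bigl[x+2\mu(2r+1)\bigr],$$ let $0=\alpha_1>\alpha_2>\dots>\alpha_{N+1}$ be the roots of $P$, let $\beta_k=\lim_{\eta\to\alpha_k}\frac{P(\eta)}{\eta-\alpha_k}$, and let $R(\alpha_k)=Q(\alpha_k)/\beta_k$, $k=1,\dots,N+1$. Then for all $t\ge0$ and $r=1,2,\dots,N$ the probability $p(r,t)$ that the multi-type Ehrenfest system contains $r$ particles at time $t$ is \begin{align*} p(r,t)={}&\frac{1}{4^N}\binom{2N}{N+r}\sum_{l=0}^N\binom{N}{l}\left(-e^{-4\mu t}\right)^l{}_2F_1(-2l,-N+r;-2N;2)\\ &+\frac{\mu N}{2^{2N-2}}(-1)^{N-r}\sum_{j=0}^{N-1}\binom{N-1}{j}(-1)^{N-1-j}\\ &\quad\times\left\{\binom{2N-1}{N+r}{}_2F_1(-2j,-N+r+1;-2N+1;2)-\binom{2N-1}{N+r-1}{}_2F_1(-2j,-N+r;-2N+1;2)\right\}\\ &\quad\times\left\{\sum_{k=1}^{N+1}\frac{R(\alpha_k)e^{-|\alpha_k|t}}{|\alpha_k|-2\mu(2N-1-2j)}-e^{-2\mu t(2N-1-2j)}\sum_{k=1}^{N+1}\frac{R(\alpha_k)}{|\alpha_k|-2\mu(2N-1-2j)}\right\}\\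 &+\frac{\mu N}{2^{2N-2}}(-1)^{N-r}\binom{2N}{N+r}\sum_{j=0}^{N-1}\binom{N-1}{j}(-1)^{N-1-j}{}_2F_1(-2j,-N+r;-2N;2)\\ &\quad\times\left\{\sum_{k=1}^{N+1}\frac{R(\alpha_k)e^{-|\alpha_k|t}}{|\alpha_k|-4\mu(N-j)}-e^{-4\mu t(N-j)}\sum_{k=1}^{N+1}\frac{R(\alpha_k)}{|\alpha_k|-4\mu(N-j)}\right\}. \end{align*}
   Context: Multi-type Ehrenfest model: let $N,d\in\mathbb N$, $D=\{1,\dots,d\}$, $\lambda,\mu>0$, and let $C=(c_{l,j})_{l,j\in D}$ be a stochastic matrix ($c_{l,j}\ge 0$, $\sum_{j}c_{l,j}=1$). The system is a continuous-time Markov chain with states $(k,j)$, $k\in\{1,\dots,N\}$, $j\in D$ ($k$ particles, all of type $j$), and the empty states $(0,l)$, $l\in D$ (no particle, the last particles in the system having been of type $l$). The only transitions are: $(k,j)\to(k-1,j)$ at rate $\mu(N+k)$ for $1\le k\le N$; $(k,j)\to(k+1,j)$ at rate $\lambda(N-k)$ for $1\le k\le N-1$; $(0,l)\to(1,j)$ at rate $c_{l,j}\lambda N$. At time $0$ the chain is in $(0,l_0)$ for a fixed $l_0\in D$. Let $p(k,j,t)$ be the probability of being in state $(k,j)$ at time $t$, $0\le k\le N$, $j\in D$, and $p(k,t)=\sum_{j\in D}p(k,j,t)$ the probability that the number of particles $\mathcal N(t)$ equals $k$ at time $t$. The Gauss hypergeometric function is ${}_2F_1(a,b;c;z)=\sum_{n\ge0}\frac{(a)_n(b)_n}{(c)_n}\frac{z^n}{n!}$,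 with $(a)_n=a(a+1)\cdots(a+n-1)$; when an upper parameter is a nonpositive integer the series is the finite sum that stops at the first $n$ after which $(a)_n(b)_n$ vanishes (this is the convention when $c$ is also a negative integer). Binomial coefficients $\binom{m}{n}$ with $n>m\geq 0$ are $0$. *)

(* Defs.v *)
(* MathComp-Analysis, over an abstract realType. *)
From HB Require Import structures.
From mathcomp Require Import all_boot all_order all_algebra.
From mathcomp Require Import all_classical all_reals all_analysis.
Import Order.TTheory GRing.Theory Num.Theory.
Import numFieldNormedType.Exports.

Set Implicit Arguments.
Unset Strict Implicit.
Unset Printing Implicit Defensive.

Local Open Scope classical_set_scope.
Local Open Scope ring_scope.

(* The values [rate x x] are ignored. *)
Definition generator (R : realType) (S : finType) (rate : S -> S -> R)
    (x y : S) : R :=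
  if x == y then - \sum_(z | z != x) rate x z else rate x y.

Record transition_function (R : realType) (S : finType)
    (Pt : R -> S -> S -> R) : Prop := {
  transition_ge0 : forall t x y, 0 <= t -> 0 <= Pt t x y ;
  transition_sum1 : forall t x, 0 <= t -> \sum_y Pt t x y = 1 ;
  transition_0 : forall x y, Pt 0 x y = (x == y)%:R ;
  transition_add : forall s t x y, 0 <= s -> 0 <= t ->
    Pt (s + t) x y = \sum_z Pt s x z * Pt t z y
}.

(* [X] (only used at times [>= 0]) is a time-homogeneous continuous-time Markov
   chain started at [x0] that jumps from [x] to [y != x] at rate [rate x y].
   The Markov property is required for the events [X u1 = z1, .., X un = zn]
   with [ui <= s], encoded by the list [past] of the pairs [(ui, zi)]; these
   events generate the past of [X] up to time [s].  It is written as a product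
   so that no conditional probability given a null event occurs. *)
Definition markov_chain (R : realType) (disp : measure_display)
    (T : measurableType disp) (Pr : probability T R) (S : finType)
    (rate : S -> S -> R) (x0 : S) (X : R -> T -> S) : Prop :=
  [/\ forall (t : R) (x : S), 0 <= t -> measurable [set w | X t w = x],
      Pr [set w | X 0 w = x0] = 1%E
    & exists Pt : R -> S -> S -> R,
      [/\ transition_function Pt,
          forall x y, (Pt h x y - (x == y)%:R) / h @[h --> 0^'+]
                        --> generator rate x y
        & forall (past : seq (R * S)) (s t : R) (x y : S), 0 <= s -> 0 <= t ->
          (forall e, e \in past -> 0 <= e.1 <= s) ->
          let A := [set w | forall e, e \in past -> X e.1 w = e.2] in
          Pr (A `&` [set w | X s w = x] `&` [set w | X (s + t) w = y]) =
          (Pr (A `&` [set w | X s w = x]) * (Pt t x y)%:E)%E]].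

Definition stochastic (R : realType) (d : nat) (C : 'M[R]_d) : Prop :=
  (forall l j, 0 <= C l j) /\ (forall l, \sum_j C l j = 1).

(* The pair [(k, j)] is the state with [k] particles of type [j] and, for
   [k = 0], the empty state whose last particles were of type [j]. *)
Definition ehrenfest_rate (R : realType) (N d : nat) (lambda mu : R)
    (C : 'M[R]_d) (x y : 'I_N.+1 * 'I_d) : R :=
  let: (k, l) := x in
  let: (k', j) := y in
  if k == 0%N :> nat then
    if k' == 1%N :> nat then C l j * lambda * N%:R else 0
  else if j != l then 0
  else if k'.+1 == k :> nat then mu * (N%:R + k%:R)
  else if k' == k.+1 :> nat then lambda * (N%:R - k%:R)
  else 0.

Definition state_prob (R : realType) (disp : measure_display)
    (T : measurableType disp) (Pr : probability T R) (N d : nat)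
    (X : R -> T -> 'I_N.+1 * 'I_d) (k : 'I_N.+1) (j : 'I_d) (t : R) : R :=
  fine (Pr [set w | X t w = (k, j)]).

Definition number_prob (R : realType) (disp : measure_display)
    (T : measurableType disp) (Pr : probability T R) (N d : nat)
    (X : R -> T -> 'I_N.+1 * 'I_d) (k : 'I_N.+1) (t : R) : R :=
  \sum_(j < d) state_prob Pr X k j t.

Definition pochhammer (R : realType) (a : R) (n : nat) : R :=
  \prod_(i < n) (a + i%:R).

(* Since [0 / 0 = 0], the terms following the vanishing of the numerator are
   all [0], also when [c] is a negative integer: the series is then the finite
   sum up to the last nonzero value of the numerator. *)
Definition hyp2F1 (R : realType) (a b c z : R) : R :=
  limn (series (fun n : nat =>
    pochhammer a n * pochhammer b n / pochhammer c n * (z ^+ n / n`!%:R))).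

Definition ehrenfest_Q (R : realType) (N : nat) (mu : R) : {poly R} :=
  \prod_(r < N) ('X + (2 * mu * (2 * r%:R + 1))%:P).

Definition ehrenfest_P (R : realType) (N : nat) (mu : R) : {poly R} :=
  'X * (\prod_(r < N) ('X + (2 * mu * (2 * r%:R + 1))%:P)
        + \prod_(r < N) ('X + (2 * mu * (2 * r%:R + 2))%:P)).

Definition ehrenfest_beta (R : realType) (N : nat) (mu a : R) : R :=
  lim ((ehrenfest_P N mu).[eta] / (eta - a) @[eta --> a^']).

Definition ehrenfest_R (R : realType) (N : nat) (mu a : R) : R :=
  (ehrenfest_Q N mu).[a] / ehrenfest_beta N mu a.

(* Main.v *)
Require Import Defs.
From HB Require Import structures.
From mathcomp Require Import all_boot all_order all_algebra.
From mathcomp Require Import all_classical all_reals all_analysis.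
From mathcomp Require Import ring lra zify.
Import Order.TTheory GRing.Theory Num.Theory.
Import numFieldNormedType.Exports.
Local Open Scope classical_set_scope.
Local Open Scope ring_scope.

Set Implicit Arguments.
Unset Strict Implicit.
Unset Printing Implicit Defensive.

(* The number of particles is itself a birth-death chain on {0, .., N}: for r
   >= 1 its rates are those of the Ehrenfest model on {-N, .., N}, while at 0
   the rate down to -1 is suppressed. Shifting by N and passing to generating
   functions, the eigenvectors (1-X)^i (1+X)^(2N-i) of the Ehrenfest model,
   with eigenvalues -2 mu i, have Krawtchouk coefficients, which are the
   hypergeometric values of the formula. Let V_a be the resolvent of the
   Ehrenfest generator at a applied to 2 mu N (X^(N-1) - X^N). Its constant
   coefficient is a multiple of 1/Q(a) + 1/Q'(a) with Q'(x) = prod (x + 2 mu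
   (2r+2)), so it vanishes at the nonzero roots a of P. The recursion then
   kills all the coefficients of degree < N and forces the one of degree N to
   be 2, so that the coefficients of degree N, .., 2N form an eigenvector of
   the chain; at a = 0 the stationary vector of the Ehrenfest model has to be
   added.

   Partial fractions of Q/P at the points -2 mu i give 0 for odd i and -1/(2 mu
   i) for even i, so that all the exponentials exp(-2 mu i t), i > 0, of the
   formula cancel and what remains is the combination sum_k R(alpha_k)
   exp(alpha_k t) V_(alpha_k). It solves the forward equation, and its value at
   t = 0 is read off the formula itself, where the two braces vanish.
   Uniqueness for linear differential equations concludes. *)

(** * Krawtchouk polynomials as eigenvectors of the Ehrenfest model *)

Definition krawtchouk_gf (R : nzRingType) (n i : nat) : {poly R} :=
  (1 - 'X) ^+ i * (1 + 'X) ^+ (n - i).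

(* On generating functions, the symmetric Ehrenfest model with [n] particles and
   rate [mu] has generator [mu *: (ehrenfest_op n p - n%:R *: p)]. *)
Definition ehrenfest_op (R : nzRingType) (n : nat) (p : {poly R}) : {poly R} :=
  (1 - 'X ^+ 2) * p^`() + n%:R *: ('X * p).

Lemma ehrenfest_op_coef0 (R : comNzRingType) n (p : {poly R}) :
  (ehrenfest_op n p)`_0 = p`_1.
Proof.
rewrite /ehrenfest_op coefD coefZ coefXM mulr0 addr0 mulrBl mul1r coefB.
by rewrite coefXnM subr0 coef_deriv.
Qed.

Lemma ehrenfest_op_coefS (R : comNzRingType) n (p : {poly R}) m :
  (ehrenfest_op n p)`_m.+1 = m.+2%:R * p`_m.+2 + (n%:R - m%:R) * p`_m.
Proof.
rewrite /ehrenfest_op coefD coefZ coefXM /= mulrBl mul1r coefB coefXnM.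
rewrite !coef_deriv -mulr_natl.
case: m => [|m] /=; first ring.
by rewrite !subSS subn0 -[p`_m.+1 *+ _]mulr_natl; ring.
Qed.

Lemma ehrenfest_opD (R : comNzRingType) n (p q : {poly R}) :
  ehrenfest_op n (p + q) = ehrenfest_op n p + ehrenfest_op n q.
Proof. by rewrite /ehrenfest_op derivD !mulrDr scalerDr; ring. Qed.

Lemma ehrenfest_opZ (R : comNzRingType) n (c : R) (p : {poly R}) :
  ehrenfest_op n (c *: p) = c *: ehrenfest_op n p.
Proof.
by rewrite /ehrenfest_op derivZ -!mul_polyC; ring.
Qed.

Lemma ehrenfest_op_sum (R : comNzRingType) n k (F : 'I_k -> {poly R}) :
  ehrenfest_op n (\sum_i F i) = \sum_i ehrenfest_op n (F i).
Proof.
apply: (big_morph (ehrenfest_op n)); first exact: ehrenfest_opD.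
by rewrite /ehrenfest_op linear0 !mulr0 scaler0 addr0.
Qed.

(** Since 1 - X^2 = (1 - X)(1 + X), the derivative term multiplies (1 - X)^i (1 + X)^a by a (1 - X)
    - i (1 + X); adding n X with n = i + a leaves the constant a - i. *)
Lemma ehrenfest_op_krawtchouk (R : comNzRingType) n i : (i <= n)%N ->
  ehrenfest_op n (krawtchouk_gf R n i) =
  (n%:R - 2 * i%:R) *: krawtchouk_gf R n i.
Proof.
rewrite /krawtchouk_gf => /subnKC; set a := (n - i)%N => <-.
have HX (x : {poly R}) k : x * (x ^+ k.-1 *+ k) = k%:R * x ^+ k.
  case: k => [|k]; first by rewrite mulr0n mulr0 mul0r.
  by rewrite -mulr_natl exprS; ring.
have e1 := HX (1 - 'X) i; have e2 := HX (1 + 'X) a.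
rewrite /ehrenfest_op derivM !deriv_exp derivB derivD derivX.
rewrite -[1]/(1%:P) derivC -!mulrnAr.
rewrite -!mul_polyC rmorphB rmorphM /= !polyC_natr natrD.
set U := _ *+ i in e1 *; set V := _ *+ a in e2 *.
set u := (_ - _) ^+ i in e1 *; set v := (_ + _) ^+ a in e2 *.
transitivity (- ((1 - 'X) * U) * (1 + 'X) * v + u * (1 - 'X) * ((1 + 'X) * V)
   + (i%:R + a%:R) * 'X * u * v); first by ring.
by rewrite e1 e2; ring.
Qed.

Lemma size_krawtchouk (R : idomainType) n i : (i <= n)%N ->
  (size (krawtchouk_gf R n i) <= n.+1)%N.
Proof.
move=> h; apply: leq_trans (size_polyMleq _ _) _.
have s1 : (size ((1 - 'X : {poly R}) ^+ i) <= i.+1)%N.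
  apply: leq_trans (size_poly_exp_leq _ _) _.
  by rewrite -opprB size_polyN size_XsubC mul1n.
have s2 : (size ((1 + 'X : {poly R}) ^+ (n - i)) <= (n - i).+1)%N.
  apply: leq_trans (size_poly_exp_leq _ _) _.
  by rewrite addrC size_XaddC mul1n.
by have := leq_add s1 s2; rewrite addSn addnS subnKC //; case: (_ + _)%N.
Qed.

Lemma krawtchouk_coef0 (R : comNzRingType) n i : (krawtchouk_gf R n i)`_0 = 1.
Proof.
rewrite -horner_coef0 /krawtchouk_gf hornerM !horner_exp hornerD hornerN.
by rewrite !hornerE /= subr0 !expr1n mulr1.
Qed.

(** Swapping the two exponents is the substitution of -X for X. *)
Lemma krawtchouk_reflect (R : comNzRingType) n i m : (i <= n)%N ->
  (krawtchouk_gf R n (n - i))`_m = (-1) ^+ m * (krawtchouk_gf R n i)`_m.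
Proof.
move=> h; rewrite /krawtchouk_gf subKn //.
have -> : (1 - 'X) ^+ (n - i) * (1 + 'X) ^+ i =
   ((1 - 'X) ^+ i * (1 + 'X) ^+ (n - i)) \Po ((-1) *: 'X) :> {poly R}.
  rewrite rmorphM !rmorphXn /= rmorphB rmorphD /= !comp_polyX !rmorph1.
  by rewrite scaleN1r opprK mulrC.
set p := _ * _; rewrite comp_polyE coef_sum.
have [mp|mp] := ltnP m (size p); last first.
  rewrite (nth_default _ mp) mulr0 big1 // => i0 _.
  rewrite coefZ exprZn coefZ coefXn.
  by case: eqP (ltn_ord i0) => [<-|]; rewrite ?ltnNge ?mp // !mulr0.
rewrite (bigD1 (Ordinal mp)) //= big1 ?addr0; last first.
  move=> i0 /eqP hi0; rewrite coefZ exprZn coefZ coefXn.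
  by case: eqP => [e|]; rewrite ?mulr0 //; case: hi0; apply: val_inj.
by rewrite coefZ exprZn coefZ coefXn eqxx mulr1 mulrC.
Qed.

(** * The resolvent applied to the boundary source *)

(** An n-th finite difference of 1/y with step c: Pascal's rule gives the sum of order n + 1 as the
    difference of the sums of order n at y and at y + c. *)
Lemma sum_alternating_inv (F : numFieldType) (n : nat) (c y : F) :
  (forall i, (i <= n)%N -> y + c * i%:R != 0) ->
  \sum_(i < n.+1) 'C(n, i)%:R * (-1) ^+ i / (y + c * i%:R) =
  c ^+ n * n`!%:R / \prod_(i < n.+1) (y + c * i%:R).
Proof.
elim: n y => [|n IH] y hy.
  by rewrite !big_ord1 bin0 expr0 fact0 !mulr1.
have hy1 i : (i <= n)%N -> y + c + c * i%:R != 0.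
  by move=> hi; move: (hy i.+1 hi); rewrite mulrS mulrDr mulr1 addrA.
have IH0 := IH y (fun i hi => hy i (leqW hi)).
have IH1 := IH (y + c) hy1.
transitivity (\sum_(i < n.+1) 'C(n, i)%:R * (-1) ^+ i / (y + c * i%:R) -
   \sum_(i < n.+1) 'C(n, i)%:R * (-1) ^+ i / (y + c + c * i%:R)).
  rewrite big_ord_recl /= [in X in _ = X - _]big_ord_recl /= -addrA.
  congr (_ + _); first by rewrite !bin0.
  under eq_bigr => i _ do
    rewrite /bump /= add1n binS natrD mulrDl mulrDl.
  rewrite big_split /= big_ord_recr /= bin_small // !mul0r addr0.
  congr (_ + _); rewrite -sumrN; apply: eq_bigr => i _.
  by rewrite mulrS mulrDr mulr1 addrA exprS mulN1r mulrN mulNr.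
rewrite IH0 IH1.
have p0 : \prod_(i < n.+1) (y + c * i%:R) != 0.
  by apply/prodf_neq0 => i _; rewrite hy // ltnW.
have p1 : \prod_(i < n.+1) (y + c + c * i%:R) != 0.
  by apply/prodf_neq0 => i _; rewrite hy1 // -ltnS.
have hl := hy n.+1 (leqnn _).
have e : \prod_(i < n.+2) (y + c * i%:R) =
     \prod_(i < n.+1) (y + c * i%:R) * (y + c * n.+1%:R) by rewrite big_ord_recr.
(* Both sides are the product of all n + 2 factors, split off at the last and at the first. *)
have e' : \prod_(i < n.+1) (y + c * i%:R) * (y + c * n.+1%:R) =
     y * \prod_(i < n.+1) (y + c + c * i%:R).
  rewrite -e big_ord_recl mulr0 addr0; congr (_ * _); apply: eq_bigr => i _.
  by rewrite /= /bump /= add1n mulrS mulrDr mulr1 addrA.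
have y0 : y != 0 by have := hy 0%N isT; rewrite mulr0 addr0.
rewrite e; move: p0 p1 e' => /=.
set A := \prod_(i < n.+1) (y + c * i%:R).
set B := \prod_(i < n.+1) (y + c + c * i%:R) => A0 B0 e'.
have -> : B = A * (y + c * n.+1%:R) / y by rewrite e'; field.
rewrite exprS factS natrM; field.
by rewrite y0 A0 /= andbT -mulrS.
Qed.

(** Up to the sign (-1)^(N - r), the coefficients of the last two sums of the formula after the
    reversal i = N - 1 - j. *)
Definition boundary_weight (R : numFieldType) N (mu : R) i : R :=
  mu * N%:R / 2 ^+ (2 * N - 2) * ('C(N - 1, i)%:R * (-1) ^+ i).

(* The resolvent at [a] of the Ehrenfest generator [mu *: (ehrenfest_op - 2 N)],
   whose eigenvectors are the Krawtchouk polynomials, applied to the source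
   [2 mu N (X^(N-1) - X^N)] decomposed in [boundary_source]. *)
Definition boundary_resolvent (R : numFieldType) N (mu a : R) : {poly R} :=
  \sum_(i < N) boundary_weight N mu i *:
    ((- a - 2 * mu * (2 * i%:R + 1))^-1 *: krawtchouk_gf R (2 * N) (2 * i + 1)
     + (- a - 2 * mu * (2 * i%:R + 2))^-1 *:
         krawtchouk_gf R (2 * N) (2 * i + 2)).

(** The pair of index i is 2 (1 - X) (1 + X)^(2(N-1-i)) (1 - X)^(2i), so the binomial theorem sums
    the pairs to a multiple of (1 - X) ((1 + X)^2 - (1 - X)^2)^(N-1) = (1 - X) (4X)^(N-1). *)
Lemma boundary_source (R : numFieldType) N (mu : R) : (0 < N)%N ->
  \sum_(i < N) boundary_weight N mu i *:
    (krawtchouk_gf R (2 * N) (2 * i + 1) + krawtchouk_gf R (2 * N) (2 * i + 2))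
  = (2 * mu * N%:R) *: ('X^(N - 1) - 'X^N).
Proof.
case: N => // n _.
set b : {poly R} := (1 - 'X) ^+ 2; set c : {poly R} := (1 + 'X) ^+ 2.
have e4 : c - b = 4%:R * 'X by rewrite /b /c; ring.
have term (i : 'I_n.+1) : krawtchouk_gf R (2 * n.+1) (2 * i + 1) +
     krawtchouk_gf R (2 * n.+1) (2 * i + 2) =
     2 * (1 - 'X) * (c ^+ (n - i) * b ^+ i).
  have hi := ltn_ord i.
  rewrite /krawtchouk_gf /b /c -!exprM.
  have -> : (2 * n.+1 - (2 * i + 1) = 2 * (n - i) + 1)%N by lia.
  have -> : (2 * n.+1 - (2 * i + 2) = 2 * (n - i))%N by lia.
  by rewrite !exprD; ring.
have -> : 'X^(n.+1 - 1) - 'X^(n.+1) = (1 - 'X) * 'X^n :> {poly R}.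
  by rewrite subn1 /= exprS; ring.
rewrite (eq_bigr (fun i : 'I_n.+1 => ((mu * n.+1%:R / 2 ^+ (2 * n.+1 - 2))%:P *
   (2 * (1 - 'X)) * (c ^+ (n - i) * (- b) ^+ i *+ 'C(n, i))))); last first.
  move=> i _; rewrite term /boundary_weight -mul_polyC !rmorphM /= subn1 /=.
  by rewrite rmorph_sign polyC_natr -mulr_natl (exprNn b); ring.
rewrite -mulr_sumr -exprDn e4 exprMn -mul_polyC.
have -> : (2 * n.+1 - 2 = 2 * n)%N by lia.
have -> : 4%:R ^+ n = ((2 ^+ (2 * n))%:P : {poly R}).
  by rewrite rmorphXn /= polyC_natr exprM -[4%N]/(2 * 2)%N natrM -expr2.
have h2 : (2 : R) ^+ (2 * n) != 0 by rewrite expf_neq0 // pnatr_eq0.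
have -> : (2 * mu * n.+1%:R)%:P =
   (mu * n.+1%:R / 2 ^+ (2 * n))%:P * 2 * (2 ^+ (2 * n))%:P :> {poly R}.
  have -> : (2 : {poly R}) = 2%:P by rewrite polyC_natr.
  by rewrite -!rmorphM /=; congr (_%:P); field.
ring.
Qed.

(** On the Krawtchouk polynomial of index j the eigenvalue 2 mu N - 2 mu j splits as (2 mu N + a) +
    (- a - 2 mu j); the second part cancels the denominator and leaves the source. *)
Lemma boundary_resolvent_eq (R : numFieldType) N (mu a : R) : (0 < N)%N ->
  (forall i, (i < N)%N -> - a - 2 * mu * (2 * i%:R + 1) != 0) ->
  (forall i, (i < N)%N -> - a - 2 * mu * (2 * i%:R + 2) != 0) ->
  mu *: ehrenfest_op (2 * N) (boundary_resolvent N mu a) =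
  (2 * mu * N%:R + a) *: boundary_resolvent N mu a
  + (2 * mu * N%:R) *: ('X^(N - 1) - 'X^N).
Proof.
move=> N0 odd0 even0; rewrite -boundary_source //.
rewrite /boundary_resolvent ehrenfest_op_sum !scaler_sumr -big_split /=.
apply: eq_bigr => i _; have hi := ltn_ord i.
have o0 := odd0 _ hi; have e0 := even0 _ hi.
rewrite !(ehrenfest_opZ, ehrenfest_opD) !ehrenfest_op_krawtchouk; try lia.
rewrite !scalerDr !scalerA addrACA -!scalerDl.
by congr (_ *: _ + _ *: _); rewrite natrM natrD (natrM _ 2 i); field.
Qed.

(** Every Krawtchouk polynomial has constant coefficient 1, so the odd and the even terms form two
    alternating sums over progressions of step 4 mu, starting at a + 2 mu and a + 4 mu. *)
Lemma boundary_resolvent_coef0 (R : numFieldType) N (mu a : R) : (0 < N)%N ->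
  (forall i, (i < N)%N -> a + 2 * mu * (2 * i%:R + 1) != 0) ->
  (forall i, (i < N)%N -> a + 2 * mu * (2 * i%:R + 2) != 0) ->
  (boundary_resolvent N mu a)`_0 =
  - (mu * N%:R / 2 ^+ (2 * N - 2) * ((4 * mu) ^+ (N - 1) * (N - 1)`!%:R) *
    ((\prod_(r < N) (a + 2 * mu * (2 * r%:R + 1)))^-1 +
     (\prod_(r < N) (a + 2 * mu * (2 * r%:R + 2)))^-1)).
Proof.
case: N => // n _ o0 e0.
have eo (i : nat) : a + 2 * mu * (2 * i%:R + 1) = a + 2 * mu + 4 * mu * i%:R.
  by ring.
have ee (i : nat) : a + 2 * mu * (2 * i%:R + 2) = a + 4 * mu + 4 * mu * i%:R.
  by ring.
have so : \sum_(i < n.+1) 'C(n, i)%:R * (-1) ^+ i / (a + 2 * mu * (2 * i%:R + 1))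
  = (4 * mu) ^+ n * n`!%:R / \prod_(i < n.+1) (a + 2 * mu * (2 * i%:R + 1)).
  under eq_bigr do rewrite eo; under [in RHS]eq_bigr do rewrite eo.
  by apply: sum_alternating_inv => i hi; rewrite -eo; apply: o0.
have se : \sum_(i < n.+1) 'C(n, i)%:R * (-1) ^+ i / (a + 2 * mu * (2 * i%:R + 2))
  = (4 * mu) ^+ n * n`!%:R / \prod_(i < n.+1) (a + 2 * mu * (2 * i%:R + 2)).
  under eq_bigr do rewrite ee; under [in RHS]eq_bigr do rewrite ee.
  by apply: sum_alternating_inv => i hi; rewrite -ee; apply: e0.
rewrite subn1 /= -mulrA [X in - (_ * X)]mulrDr -so -se -big_split mulr_sumr.
rewrite -sumrN /=.
rewrite /boundary_resolvent coef_sum; apply: eq_bigr => i _.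
rewrite coefZ coefD !coefZ !krawtchouk_coef0 !mulr1 /boundary_weight subn1 /=.
by rewrite -!opprD !invrN; ring.
Qed.

Lemma boundary_coef_eq (R : numFieldType) N (mu a : R) (p : {poly R}) :
  mu *: ehrenfest_op (2 * N) p = (2 * mu * N%:R + a) *: p
    + (2 * mu * N%:R) *: ('X^(N - 1) - 'X^N) ->
  forall m, mu * (ehrenfest_op (2 * N) p)`_m = (2 * mu * N%:R + a) * p`_m
    + 2 * mu * N%:R * ((m == N - 1)%N%:R - (m == N)%:R).
Proof.
move=> /polyP hp m; have := hp m; move: (ehrenfest_op _ _) => q.
by rewrite coefZ coefD !coefZ coefB !coefXn.
Qed.

Lemma boundary_coefs (R : numFieldType) N (mu a : R) (p : {poly R}) :
  (0 < N)%N -> mu != 0 -> p`_0 = 0 ->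
  mu *: ehrenfest_op (2 * N) p = (2 * mu * N%:R + a) *: p
    + (2 * mu * N%:R) *: ('X^(N - 1) - 'X^N) ->
  (forall m, (m < N)%N -> p`_m = 0) /\ p`_N = 2.
Proof.
move=> N0 mu0 p0 /boundary_coef_eq hp.
have low m : (m < N)%N -> p`_m = 0.
  elim/ltn_ind: m => -[//|m] IH hm.
  have := hp m; rewrite IH //; last lia.
  have -> : (m == N - 1)%N = false by apply/eqP; lia.
  have -> : (m == N)%N = false by apply/eqP; lia.
  rewrite subrr !mulr0 addr0; case: m IH hm => [|m] IH hm.
    by rewrite ehrenfest_op_coef0 => /eqP; rewrite mulf_eq0 (negPf mu0) => /eqP.
  rewrite ehrenfest_op_coefS (IH m) //; last lia.
  rewrite mulr0 addr0 => /eqP; rewrite !mulf_eq0 (negPf mu0) pnatr_eq0.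
  by move=> /eqP.
split=> //; have := hp (N - 1)%N.
rewrite eqxx.
have -> : (N - 1 == N)%N = false by apply/eqP; lia.
rewrite low ?mulr0 ?add0r ?subr0 ?mulr1; last lia.
case: N N0 low hp => // n _ low hp; rewrite subn1 /=.
have n0 : n.+1%:R != 0 :> R by rewrite pnatr_eq0.
case: n n0 low hp => [|m] n0 low hp.
  by rewrite ehrenfest_op_coef0 mulr1 => h; apply: (mulfI mu0); rewrite h; ring.
rewrite ehrenfest_op_coefS (low m); last lia.
rewrite mulr0 addr0 => h.
by apply: (mulfI mu0); apply: (mulfI n0); rewrite mulrCA h; ring.
Qed.

(** At degree N the value p_N = 2 makes the source - 2 mu N equal to - mu N p_N, which halves the
    exit rate 2 mu N, while p_(N-1) = 0 removes the inflow from below: this is the boundary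
    condition of the number chain at 0. *)
Lemma boundary_eigen (R : numFieldType) N (mu a : R) (p : {poly R}) :
  (0 < N)%N -> mu != 0 -> p`_0 = 0 ->
  mu *: ehrenfest_op (2 * N) p = (2 * mu * N%:R + a) *: p
    + (2 * mu * N%:R) *: ('X^(N - 1) - 'X^N) ->
  a * p`_N = mu * (N%:R + 1) * p`_N.+1 - mu * N%:R * p`_N /\
  forall r, a * p`_(N + r.+1) = mu * (N%:R - r%:R) * p`_(N + r)
    + mu * (N%:R + r.+2%:R) * p`_(N + r.+2) - 2 * mu * N%:R * p`_(N + r.+1).
Proof.
move=> N0 mu0 p0 hp; have [low pN] := boundary_coefs N0 mu0 p0 hp.
move/boundary_coef_eq: hp => hp; split.
  have := hp N; rewrite eqxx.
  have -> : (N == N - 1)%N = false by apply/eqP; lia.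
  rewrite pN; case: N N0 low {p0 hp pN} => // n _ low.
  rewrite ehrenfest_op_coefS (low n) // mulr0 addr0 -[n.+2%:R]natr1 => h.
  by rewrite -[mu * _ * p`__]mulrA h mulr0n mulr1n; ring.
move=> r; have := hp (N + r.+1)%N.
have -> : (N + r.+1 == N - 1)%N = false by apply/eqP; lia.
have -> : (N + r.+1 == N)%N = false by apply/eqP; lia.
rewrite subrr mulr0 addr0 !addnS ehrenfest_op_coefS => h.
transitivity (mu * ((N + r).+2%:R * p`_(N + r).+2 +
     ((2 * N)%:R - (N + r)%:R) * p`_(N + r)) - 2 * mu * N%:R * p`_(N + r).+1).
  by rewrite h; ring.
by rewrite -!addnS natrM !(natrD _ N); ring.
Qed.

(** * Terminating hypergeometric series as Krawtchouk coefficients *)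

Lemma pochhammerN (R : realType) (k s : nat) :
  pochhammer (- k%:R) s = (-1) ^+ s * (k ^_ s)%:R :> R.
Proof.
rewrite /pochhammer; elim: s => [|s IH].
  by rewrite big_ord0 ffactn0 mulr1.
rewrite big_ord_recr /= IH ffactnSr natrM exprS.
have [ks|ks] := leqP s k; first by rewrite natrB //; ring.
by rewrite ffact_small // !(mulr0, mul0r).
Qed.

Lemma limn_series_finite (R : realType) (u : R^nat) n :
  (forall i, (n <= i)%N -> u i = 0) -> limn (series u) = \sum_(i < n) u i.
Proof.
move=> u0; apply/cvg_lim => //; apply: cvg_near_cst; near=> m.
have nm : (n <= m)%N by near: m; exact: nbhs_infty_ge.
rewrite /series /= (big_cat_nat (leq0n n) nm) /= big_mkord.
rewrite [X in _ + X]big_nat_cond.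
by rewrite [X in _ + X]big1 ?addr0 // => i /andP[/andP[hi _] _]; exact: u0.
Unshelve. all: by end_near. Qed.

(** Both sides count the pairs of an m-subset and a sequence of s distinct elements outside it,
    choosing one or the other first. *)
Lemma bin_ffactB n m s :
  ('C(n, m) * (n - m) ^_ s = 'C(n - s, m) * n ^_ s)%N.
Proof.
elim: s => [|s IH]; first by rewrite subn0.
rewrite !ffactnSr mulnA IH subnS.
have h : ((n - m - s) * 'C(n - s, m) = (n - s) * 'C((n - s).-1, m))%N.
  by rewrite subnAC mul_bin_down.
transitivity (n ^_ s * ((n - m - s) * 'C(n - s, m)))%N; first by ring.
by rewrite h; ring.
Qed.

Lemma coef_1addX_exp (R : comNzRingType) n m :
  ((1 + 'X : {poly R}) ^+ n)`_m = 'C(n, m)%:R.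
Proof.
rewrite addrC exprD1n coef_sum.
under eq_bigr => i _ do rewrite coefMn coefXn.
have [mn|mn] := ltnP m n.+1; last first.
  rewrite bin_small // big1 // => i _.
  have := ltn_ord i; case: eqP => [e|_ _]; last by rewrite mul0rn.
  by rewrite -e ltnNge mn.
rewrite (bigD1 (Ordinal mn)) //= eqxx big1 ?addr0 // => i /eqP hi.
by case: eqP => [e|]; rewrite ?mul0rn //; case: hi; apply: val_inj.
Qed.

(** Expanding (1 - X)^(2j) = ((1 + X) - 2)^(2j), where the even exponent absorbs the sign, gives the
    terms (-2)^s C(2j, s) C(n-s, m). This 2 is the argument of the series, and [bin_ffactB] turns
    C(n-s, m) into a quotient of Pochhammer symbols. *)
Lemma hyp2F1_krawtchouk (R : realType) n m j : (2 * j <= n)%N -> (m <= n)%N ->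
  'C(n, m)%:R * hyp2F1 (- (2 * j%:R)) (- n%:R + m%:R) (- n%:R) 2 =
  (krawtchouk_gf R n (2 * j))`_m.
Proof.
move=> jn mn.
have -> : - (2 * j%:R) = - (2 * j)%:R :> R by rewrite natrM.
have -> : - n%:R + m%:R = - (n - m)%:R :> R by rewrite natrB // opprB addrC.
rewrite /hyp2F1 (@limn_series_finite _ _ (2 * j).+1); last first.
  by move=> i hi; rewrite pochhammerN ffact_small // !(mulr0, mul0r).
have -> : krawtchouk_gf R n (2 * j) = \sum_(s < (2 * j).+1)
    ((1 + 'X) ^+ (n - s) * ((- 2) ^+ s *+ 'C(2 * j, s))%:P).
  rewrite /krawtchouk_gf.
  have -> : (1 - 'X) ^+ (2 * j) = ((1 + 'X) - 2%:P) ^+ (2 * j) :> {poly R}.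
    by rewrite !exprM; congr (_ ^+ _); rewrite polyC_natr; ring.
  rewrite exprDn mulr_suml; apply: eq_bigr => s _.
  have sj : (s <= 2 * j)%N by rewrite -ltnS.
  have -> : (n - s = (2 * j - s) + (n - 2 * j))%N by lia.
  by rewrite exprD -polyCN -rmorphXn -mulrnAr rmorphMn mulrAC.
rewrite coef_sum mulr_sumr; apply: eq_bigr => s _.
have sj : (s <= 2 * j)%N by rewrite -ltnS.
rewrite coefMC coef_1addX_exp !pochhammerN.
(* The bound s <= 2 j <= n keeps the Pochhammer symbol of - n in the denominator nonzero. *)
have f0 : (n ^_ s)%:R != 0 :> R.
  by rewrite pnatr_eq0 -lt0n ffact_gt0; lia.
have s0 : s`!%:R != 0 :> R by rewrite pnatr_eq0 -lt0n fact_gt0.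
have e1 : (2 * j) ^_ s = ('C(2 * j, s) * s`!)%N by rewrite bin_ffact.
have e2 : 'C(n, m)%:R * ((n - m) ^_ s)%:R = 'C(n - s, m)%:R * (n ^_ s)%:R :> R.
  by rewrite -!natrM bin_ffactB.
have sg : (-1) ^+ s * (-1) ^+ s = 1 :> R by rewrite -expr2 sqrr_sign.
have sgn0 : (-1) ^+ s != 0 :> R by rewrite signr_eq0.
rewrite e1 natrM -mulr_natl [(- 2) ^+ s]exprNn.
transitivity (('C(n, m)%:R * ((n - m) ^_ s)%:R) * ('C(2 * j, s)%:R *
   ((-1) ^+ s) * 2 ^+ s / (n ^_ s)%:R) : R).
  by field; rewrite sgn0 f0 s0.
by rewrite e2; field.
Qed.

(** * Partial fractions *)

(** Lagrange interpolation of q at the n points [a k], exact because q has degree less than n. *)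
Lemma partial_fractions (F : fieldType) n (a : 'I_n -> F) (q : {poly F}) x :
  injective a -> (size q <= n)%N -> (forall k, x != a k) ->
  q.[x] / \prod_k (x - a k) =
  \sum_k q.[a k] / (\prod_(j | j != k) (a k - a j)) / (x - a k).
Proof.
move=> inj sq xa.
pose S k := \prod_(j | j != k) ('X - (a j)%:P) : {poly F}.
have SE k y : (S k).[y] = \prod_(j | j != k) (y - a j).
  by rewrite /S horner_prod; apply: eq_bigr => j _; rewrite hornerXsubC.
have S0 k j : j != k -> (S k).[a j] = 0.
  by move=> jk; rewrite SE (bigD1 j) //= subrr mul0r.
have Sn0 k : (S k).[a k] != 0.
  rewrite SE; apply/prodf_neq0 => j jk; rewrite subr_eq0.
  by apply: contra jk => /eqP /inj ->.
pose L := \sum_k (q.[a k] / (S k).[a k]) *: S k.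
have qL : q = L.
  apply/eqP; rewrite -subr_eq0; apply/eqP.
  apply: (@roots_geq_poly_eq0 _ _ (map a (enum 'I_n))).
  - apply/allP => y /mapP[k _ ->]; rewrite /root hornerD hornerN /L horner_sum.
    rewrite (bigD1 k) //= big1 ?addr0; last first.
      by move=> j jk; rewrite hornerZ (S0 j k) ?mulr0 // eq_sym.
    by rewrite hornerZ divfK ?subrr.
  - by rewrite map_inj_uniq ?enum_uniq.
  rewrite size_map size_enum_ord.
  apply: leq_trans (size_polyD _ _) _; rewrite geq_max sq size_polyN.
  apply: leq_trans (size_sum _ _ _) _; apply/bigmax_leqP => k _.
  apply: leq_trans (size_scale_leq _ _) _.
  rewrite /S -big_filter size_prod_XsubC.
  have [e _ _ [_ ->]] := big_enumP (fun j : 'I_n => j != k).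
  by rewrite cardC1 card_ord prednK // (leq_ltn_trans _ (ltn_ord k)).
rewrite {1}qL /L horner_sum mulr_suml; apply: eq_bigr => k _.
rewrite hornerZ !SE [X in _ / X = _](bigD1 k) //=.
have p0 : \prod_(j | j != k) (x - a j) != 0.
  by apply/prodf_neq0 => j _; rewrite subr_eq0.
have xk : x - a k != 0 by rewrite subr_eq0.
have k0 := Sn0 k; rewrite SE in k0.
by field; rewrite p0 xk k0.
Qed.

Lemma lim_factor_quotient (R : realType) (p s : {poly R}) a :
  p = ('X - a%:P) * s -> lim (p.[eta] / (eta - a) @[eta --> a^']) = s.[a].
Proof.
move=> ->; apply/cvg_lim => //.
have h : s.[eta] @[eta --> a^'] --> s.[a].
  apply: cvg_within_filter; exact: continuous_horner.
apply: cvg_trans h; apply: near_eq_cvg; near=> eta.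
have ea : eta - a != 0.
  rewrite subr_eq0; near: eta; exact: nbhs_dnbhs_neq.
by rewrite hornerM hornerXsubC mulrAC divff // mul1r.
Unshelve. all: by end_near. Qed.

(** * The formula in terms of Krawtchouk coefficients *)

(** One brace of the formula; where the denominators are nonzero, it is minus the convolution on
    [0, t] of exp(- b s) with sum_k rho_k exp(alpha_k s). *)
Definition transient (R : realType) n (rho alpha : 'I_n -> R) (b t : R) : R :=
  \sum_k rho k * expR (alpha k * t) / (- alpha k - b)
  - expR (- (b * t)) * \sum_k rho k / (- alpha k - b).

(** The right-hand side of the theorem for m = N + r, with the index of the last two sums reversed
    so that the rates are attached to the polynomials whose eigenvalues they are. *)
Definition krawtchouk_form (R : realType) N n (mu : R) (rho alpha : 'I_n -> R)
    m (t : R) : R :=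
  (4 ^+ N)^-1 * (\sum_(l < N.+1) 'C(N, l)%:R * (- expR (- (4 * mu * t))) ^+ l *
    (krawtchouk_gf R (2 * N) (2 * l))`_m)
  + \sum_(i < N) boundary_weight N mu i *
     ((krawtchouk_gf R (2 * N) (2 * i + 1))`_m *
        transient rho alpha (2 * mu * (2 * i%:R + 1)) t
      + (krawtchouk_gf R (2 * N) (2 * i + 2))`_m *
        transient rho alpha (2 * mu * (2 * i%:R + 2)) t).

(** At t = 0 each brace is a difference of equal sums, and the first sum becomes the binomial
    expansion of ((1 + X)^2 - (1 - X)^2)^N = (4X)^N. *)
Lemma krawtchouk_form0 (R : realType) N n (mu : R) (rho alpha : 'I_n -> R) m :
  krawtchouk_form N mu rho alpha m 0 = (m == N)%:R.
Proof.
have T0 b : transient rho alpha b 0 = 0.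
  rewrite /transient mulr0 oppr0 expR0 mul1r; apply/eqP; rewrite subr_eq0.
  by apply/eqP; apply: eq_bigr => k _; rewrite mulr0 expR0 mulr1.
rewrite /krawtchouk_form [X in _ + X]big1 ?addr0; last first.
  by move=> i _; rewrite !T0 !mulr0 addr0 mulr0.
have e : \sum_(l < N.+1) ('C(N, l)%:R * (-1) ^+ l : R) *:
     krawtchouk_gf R (2 * N) (2 * l) = 4 ^+ N *: 'X^N.
  set b : {poly R} := (1 - 'X) ^+ 2; set c : {poly R} := (1 + 'X) ^+ 2.
  have e4 : c - b = 4%:R * 'X by rewrite /b /c; ring.
  rewrite -mul_polyC rmorphXn /= polyC_natr -exprMn -e4 exprDn.
  apply: eq_bigr => l _.
  rewrite /krawtchouk_gf -mul_polyC rmorphM rmorph_sign /= polyC_natr.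
  rewrite (exprNn b) /b /c -!exprM -mulnBr -mulr_natl; ring.
have -> : \sum_(l < N.+1) 'C(N, l)%:R * (- expR (- (4 * mu * 0))) ^+ l *
    (krawtchouk_gf R (2 * N) (2 * l))`_m =
    (\sum_(l < N.+1) ('C(N, l)%:R * (-1) ^+ l : R) *:
     krawtchouk_gf R (2 * N) (2 * l))`_m.
  rewrite coef_sum; apply: eq_bigr => l _.
  by rewrite coefZ mulr0 oppr0 expR0.
by rewrite e coefZ coefXn mulKf // expf_neq0 // pnatr_eq0.
Qed.

(** The first family of sums removes the second exponential from the odd braces; the second makes
    that of the even brace i cancel the term l = i + 1 of the first sum, so that only l = 0 survives
    there. *)
Lemma krawtchouk_form_spectral (R : realType) N n (mu : R)
    (rho alpha : 'I_n -> R) m (t : R) : mu != 0 ->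
  (forall i, (i < N)%N ->
     \sum_k rho k / (- alpha k - 2 * mu * (2 * i%:R + 1)) = 0) ->
  (forall i, (i < N)%N ->
     \sum_k rho k / (- alpha k - 2 * mu * (2 * i%:R + 2)) =
     - (2 * mu * (2 * i%:R + 2))^-1) ->
  krawtchouk_form N mu rho alpha m t =
  (4 ^+ N)^-1 * (krawtchouk_gf R (2 * N) 0)`_m
  + \sum_k rho k * expR (alpha k * t) *
     (boundary_resolvent N mu (alpha k))`_m.
Proof.
move=> mu0 ho he; rewrite /krawtchouk_form.
set K := fun i => (krawtchouk_gf R (2 * N) i)`_m.
rewrite big_ord_recl muln0 bin0 expr0 !mul1r mulrDr -addrA; congr (_ + _).
pose D (i : 'I_N) := \sum_k rho k * expR (alpha k * t) *
    (boundary_weight N mu i *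
    ((- alpha k - 2 * mu * (2 * i%:R + 1))^-1 * K (2 * i + 1)%N +
     (- alpha k - 2 * mu * (2 * i%:R + 2))^-1 * K (2 * i + 2)%N)).
transitivity (\sum_i D i); last first.
  rewrite exchange_big; apply: eq_bigr => k _ /=.
  rewrite -mulr_sumr; congr (_ * _).
  rewrite /boundary_resolvent coef_sum; apply: eq_bigr => i _.
  by rewrite coefZ coefD !coefZ.
rewrite mulr_sumr -big_split; apply: eq_bigr => i _ /=.
have hi := ltn_ord i.
rewrite /transient ho // he // mulr0 subr0 /D.
have i0 : (2 * i%:R + 2 : R) != 0 by rewrite -natrM -natrD pnatr_eq0 addn2.
have -> : \sum_k rho k * expR (alpha k * t) * (boundary_weight N mu i *
    ((- alpha k - 2 * mu * (2 * i%:R + 1))^-1 * K (2 * i + 1)%N +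
     (- alpha k - 2 * mu * (2 * i%:R + 2))^-1 * K (2 * i + 2)%N)) =
   boundary_weight N mu i * (K (2 * i + 1)%N *
     (\sum_k rho k * expR (alpha k * t) / (- alpha k - 2 * mu * (2 * i%:R + 1)))
   + K (2 * i + 2)%N *
     (\sum_k rho k * expR (alpha k * t) / (- alpha k - 2 * mu * (2 * i%:R + 2)))).
  rewrite !mulr_sumr -big_split mulr_sumr; apply: eq_bigr => k _ /=; ring.
have -> : (2 * bump 0 i = 2 * i + 2)%N by rewrite /bump /=; lia.
rewrite /bump /= add1n exprNn -expRM_natl.
set S1 := \sum_k _; set S2 := \sum_k _.
have -> : i.+1%:R * - (4 * mu * t) = - (2 * mu * (2 * i%:R + 2) * t).
  by rewrite -natr1; ring.
set e := expR _.
(* The cancellation rests on (i + 1) C(N, i + 1) = N C(N - 1, i). *)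
have hb : boundary_weight N mu i / (2 * mu * (2 * i%:R + 2)) =
    - ((4 ^+ N)^-1 * ('C(N, i.+1)%:R * (-1) ^+ i.+1)).
  have := mul_bin_diag N i => /(congr1 (fun k => k%:R : R)).
  rewrite !natrM /boundary_weight subn1 -natr1 => hbin.
  have j0 : (i%:R + 1 : R) != 0 by rewrite natr1 pnatr_eq0.
  have -> : (2 : R) ^+ (2 * N - 2) = 4 ^+ N / 4.
    have N0 : (0 < N)%N by lia.
    have -> : (4 : R) ^+ N = 4 * 4 ^+ N.-1 by rewrite -exprS prednK.
    have -> : (2 * N - 2 = 2 * N.-1)%N by lia.
    by rewrite exprM -[4]/((2 * 2)%:R) natrM -expr2; field.
  have n4 : (4 : R) ^+ N != 0 by rewrite expf_neq0 // pnatr_eq0.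
  apply: (mulfI j0); rewrite exprS.
  transitivity (N%:R * 'C(N.-1, i)%:R * (-1) ^+ i / 4 ^+ N : R).
    by field; rewrite n4 mu0 i0.
  by rewrite hbin; field.
transitivity
 ((4 ^+ N)^-1 * ('C(N, i.+1)%:R * (-1) ^+ i.+1) * e * K (2 * i + 2)%N
  + boundary_weight N mu i / (2 * mu * (2 * i%:R + 2)) * e * K (2 * i + 2)%N
  + boundary_weight N mu i * (K (2 * i + 1)%N * S1 + K (2 * i + 2)%N * S2)).
  by rewrite /K; ring.
by rewrite hb; ring.
Qed.

(** * The polynomials P and Q and the residues of Q/P *)

Lemma ehrenfest_prodE (R : numDomainType) N (c : nat -> R) a :
  (\prod_(r < N) ('X + (c r)%:P)).[a] = \prod_(r < N) (a + c r).
Proof.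
by rewrite horner_prod; apply: eq_bigr => r _; rewrite hornerD hornerX hornerC.
Qed.

Lemma ehrenfest_QE (R : realType) N (mu a : R) :
  (ehrenfest_Q N mu).[a] = \prod_(r < N) (a + 2 * mu * (2 * r%:R + 1)).
Proof. exact: (ehrenfest_prodE N (fun r => 2 * mu * (2 * r%:R + 1))). Qed.

Lemma ehrenfest_PE (R : realType) N (mu a : R) :
  (ehrenfest_P N mu).[a] = a * ((ehrenfest_Q N mu).[a] +
    \prod_(r < N) (a + 2 * mu * (2 * r%:R + 2))).
Proof.
rewrite /ehrenfest_P hornerM hornerX hornerD; congr (_ * (_ + _)).
exact: (ehrenfest_prodE N (fun r => 2 * mu * (2 * r%:R + 2))).
Qed.

Lemma odd_neq_even (R : numDomainType) (r i : nat) :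
  2 * r%:R + 1 != 2 * i%:R + 2 :> R.
Proof. by rewrite -!natrM natr1 -natrD eqr_nat; apply/eqP; lia. Qed.

Lemma ehrenfest_P_odd_neq0 (R : realType) N (mu : R) i : 0 < mu -> (i < N)%N ->
  (ehrenfest_P N mu).[- (2 * mu * (2 * i%:R + 1))] != 0.
Proof.
move=> mu0 iN; rewrite ehrenfest_PE ehrenfest_QE.
rewrite (bigD1 (Ordinal iN)) //= addNr mul0r add0r.
rewrite mulf_neq0 ?oppr_eq0 //; first by rewrite gt_eqF // !mulr_gt0 //; lra.
apply/prodf_neq0 => r _; rewrite addrC -mulrBr mulf_neq0 //.
  by rewrite gt_eqF // mulr_gt0.
by rewrite subr_eq0 eq_sym odd_neq_even.
Qed.

(** The even product vanishes at such a point x, so P(x) = x Q(x) and Q/P takes the value 1/x. *)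
Lemma ehrenfest_even (R : realType) N (mu : R) i : 0 < mu -> (i < N)%N ->
  (ehrenfest_Q N mu).[- (2 * mu * (2 * i%:R + 2))] != 0 /\
  (ehrenfest_P N mu).[- (2 * mu * (2 * i%:R + 2))] =
  - (2 * mu * (2 * i%:R + 2)) * (ehrenfest_Q N mu).[- (2 * mu * (2 * i%:R + 2))].
Proof.
move=> mu0 iN; split; last first.
  rewrite ehrenfest_PE; congr (_ * _).
  by rewrite [X in _ + X](bigD1 (Ordinal iN)) //= addNr mul0r addr0.
rewrite ehrenfest_QE.
apply/prodf_neq0 => r _; rewrite addrC -mulrBr mulf_neq0 //.
  by rewrite gt_eqF // mulr_gt0.
by rewrite subr_eq0 odd_neq_even.
Qed.

Lemma ehrenfest_P_even_neq0 (R : realType) N (mu : R) i : 0 < mu -> (i < N)%N ->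
  (ehrenfest_P N mu).[- (2 * mu * (2 * i%:R + 2))] != 0.
Proof.
move=> mu0 iN; have [q0 ->] := ehrenfest_even mu0 iN.
by rewrite mulf_neq0 // oppr_eq0 gt_eqF // !mulr_gt0 //; lra.
Qed.

(** P has degree N + 1 and N + 1 distinct roots, hence splits with simple roots; its leading
    coefficient is 2 because the bracket adds two monic polynomials of degree N. *)
Lemma ehrenfest_P_factor (R : realType) N (mu : R) (alpha : 'I_N.+1 -> R) :
  injective alpha -> (forall k, root (ehrenfest_P N mu) (alpha k)) ->
  ehrenfest_P N mu = 2 *: \prod_k ('X - (alpha k)%:P).
Proof.
move=> inj hroot.
have mon (c : nat -> R) : \prod_(r < N) ('X + (c r)%:P) \is monic /\
    size (\prod_(r < N) ('X + (c r)%:P)) = N.+1.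
  under eq_bigr => r _ do rewrite -[(c r)%:P]opprK -polyCN.
  rewrite monic_prod_XsubC size_prod_XsubC; split=> //.
  by rewrite /index_enum -enumT size_enum_ord.
have [mo so] := mon (fun r => 2 * mu * (2 * r%:R + 1)).
have [me se] := mon (fun r => 2 * mu * (2 * r%:R + 2)).
rewrite /ehrenfest_P; set q1 := \prod_(r < N) _ in mo so *.
set q2 := \prod_(r < N) _ in me se *.
have cN : (q1 + q2)`_N = 2.
  by move: mo me; rewrite !monicE /lead_coef so se coefD => /eqP -> /eqP ->.
have sS : size (q1 + q2) = N.+1.
  apply/eqP; rewrite eqn_leq; apply/andP; split.
    by rewrite (leq_trans (size_polyD _ _)) // so se maxnn.
  rewrite ltnNge; apply/negP => h; move/eqP: cN.
  by rewrite nth_default // eq_sym pnatr_eq0.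
have S0 : q1 + q2 != 0 by rewrite -size_poly_eq0 sS.
have h := @all_roots_prod_XsubC _ ('X * (q1 + q2)) (map alpha (enum 'I_N.+1)).
rewrite h.
- rewrite lead_coefM lead_coefX mul1r {1}/lead_coef sS cN big_map big_enum.
  by [].
- by rewrite mulrC size_mulX // sS size_map size_enum_ord.
- by apply/allP => y /mapP[k _ ->]; exact: hroot.
- by rewrite uniq_rootsE map_inj_uniq ?enum_uniq.
Qed.

Lemma ehrenfest_betaE (R : realType) N (mu : R) (alpha : 'I_N.+1 -> R) k :
  injective alpha -> (forall k, root (ehrenfest_P N mu) (alpha k)) ->
  ehrenfest_beta N mu (alpha k) =
  2 * \prod_(j | j != k) (alpha k - alpha j).
Proof.
move=> inj hroot; rewrite /ehrenfest_beta.
rewrite (@lim_factor_quotient _ _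
  (2 *: \prod_(j | j != k) ('X - (alpha j)%:P))).
  rewrite hornerZ horner_prod; congr (_ * _); apply: eq_bigr => j _.
  by rewrite hornerXsubC.
by rewrite (ehrenfest_P_factor inj hroot) (bigD1 k) //= scalerAr.
Qed.

Lemma size_ehrenfest_Q (R : realType) N (mu : R) :
  size (ehrenfest_Q N mu) = N.+1.
Proof.
rewrite /ehrenfest_Q.
under eq_bigr => r _ do
  rewrite -[(2 * mu * (2 * r%:R + 1))%:P]opprK -polyCN.
by rewrite size_prod_XsubC /index_enum -enumT size_enum_ord.
Qed.

(** [ehrenfest_R] at [alpha k] is the residue of Q/P at a simple pole, and the degree N of Q is less
    than the number N + 1 of poles. *)
Lemma ehrenfest_R_sum (R : realType) N (mu : R) (alpha : 'I_N.+1 -> R) x :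
  injective alpha -> (forall k, root (ehrenfest_P N mu) (alpha k)) ->
  (ehrenfest_P N mu).[x] != 0 ->
  \sum_k ehrenfest_R N mu (alpha k) / (x - alpha k) =
  (ehrenfest_Q N mu).[x] / (ehrenfest_P N mu).[x].
Proof.
move=> inj hroot px.
have xa k : x != alpha k.
  by apply: contraNneq px => ->; exact: hroot.
have h := partial_fractions inj (eq_leq (size_ehrenfest_Q N mu)) xa.
have -> : (ehrenfest_P N mu).[x] = 2 * \prod_k (x - alpha k).
  rewrite (ehrenfest_P_factor inj hroot) hornerZ horner_prod.
  by congr (_ * _); apply: eq_bigr => k _; rewrite hornerXsubC.
rewrite invfM mulrCA h mulr_sumr; apply: eq_bigr => k _.
by rewrite /ehrenfest_R (ehrenfest_betaE k inj hroot) invfM; ring.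
Qed.

Lemma ehrenfest_R0 (R : realType) N (mu : R) :
  ehrenfest_R N mu 0 = (ehrenfest_Q N mu).[0] /
    ((ehrenfest_Q N mu).[0] + \prod_(r < N) (2 * mu * (2 * r%:R + 2))).
Proof.
rewrite /ehrenfest_R /ehrenfest_beta; congr (_ / _).
rewrite (@lim_factor_quotient _ _ (ehrenfest_Q N mu +
  \prod_(r < N) ('X + (2 * mu * (2 * r%:R + 2))%:P))); last first.
  by rewrite subr0.
rewrite hornerD; congr (_ + _).
rewrite (ehrenfest_prodE N (fun r => 2 * mu * (2 * r%:R + 2))).
by under eq_bigr do rewrite add0r.
Qed.

(** * Eigenvectors attached to the roots of P *)

Lemma prod_even (R : realType) N (mu : R) :
  \prod_(r < N) (2 * mu * (2 * r%:R + 2)) = (4 * mu) ^+ N * N`!%:R.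
Proof.
elim: N => [|N IH]; first by rewrite big_ord0 fact0 mulr1.
by rewrite big_ord_recr /= IH exprS factS natrM -natr1; ring.
Qed.

(* Subtracting the constant coefficient only changes the root [a = 0], where it
   adds the stationary vector of the Ehrenfest model on [0, 2N]. *)
Definition boundary_eigenpoly (R : realType) N (mu a : R) : {poly R} :=
  boundary_resolvent N mu a
  - (boundary_resolvent N mu a)`_0 *: krawtchouk_gf R (2 * N) 0.

Lemma boundary_eigenpoly_coef0 (R : realType) N (mu a : R) :
  (boundary_eigenpoly N mu a)`_0 = 0.
Proof. by rewrite coefB coefZ krawtchouk_coef0 mulr1 subrr. Qed.

Lemma size_boundary_eigenpoly (R : realType) N (mu a : R) :
  (size (boundary_eigenpoly N mu a) <= (2 * N).+1)%N.
Proof.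
apply: leq_trans (size_polyD _ _) _; rewrite geq_max size_polyN; apply/andP.
split; last first.
  by apply: leq_trans (size_scale_leq _ _) _; exact: size_krawtchouk.
apply: leq_trans (size_sum _ _ _) _; apply/bigmax_leqP => i _.
apply: leq_trans (size_scale_leq _ _) _.
apply: leq_trans (size_polyD _ _) _; rewrite geq_max; have := ltn_ord i => hi.
by apply/andP; split; apply: leq_trans (size_scale_leq _ _) _;
  apply: size_krawtchouk; lia.
Qed.

Lemma root_odd_neq0 (R : realType) N (mu a : R) i :
  0 < mu -> root (ehrenfest_P N mu) a -> (i < N)%N ->
  a + 2 * mu * (2 * i%:R + 1) != 0.
Proof.
move=> mu0 ra iN; apply: contraTneq ra => /eqP; rewrite addr_eq0 => /eqP ->.
exact: ehrenfest_P_odd_neq0.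
Qed.

Lemma root_even_neq0 (R : realType) N (mu a : R) i :
  0 < mu -> root (ehrenfest_P N mu) a -> (i < N)%N ->
  a + 2 * mu * (2 * i%:R + 2) != 0.
Proof.
move=> mu0 ra iN; apply: contraTneq ra => /eqP; rewrite addr_eq0 => /eqP ->.
exact: ehrenfest_P_even_neq0.
Qed.

Lemma boundary_resolvent_root (R : realType) N (mu a : R) :
  (0 < N)%N -> 0 < mu -> root (ehrenfest_P N mu) a -> a != 0 ->
  (boundary_resolvent N mu a)`_0 = 0.
Proof.
move=> N0 mu0 ra a0.
have o0 := fun i => @root_odd_neq0 _ _ _ _ i mu0 ra.
have e0 := fun i => @root_even_neq0 _ _ _ _ i mu0 ra.
rewrite boundary_resolvent_coef0 // -ehrenfest_QE.
move: ra; rewrite /root ehrenfest_PE mulf_eq0 (negPf a0) /= addr_eq0 => /eqP ->.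
by rewrite invrN addNr mulr0 oppr0.
Qed.

(** With Q' the even product, the coefficient is a multiple of (Q + Q')/(Q Q') at 0 and R(0) = Q/(Q
    + Q'), so Q cancels; Q'(0) = (4 mu)^N N! then leaves 4^(-N), the weight of the stationary term
    in [krawtchouk_form_spectral]. *)
Lemma boundary_resolvent0 (R : realType) N (mu : R) :
  (0 < N)%N -> 0 < mu ->
  - ((boundary_resolvent N mu 0)`_0 * ehrenfest_R N mu 0) = (4 ^+ N)^-1.
Proof.
move=> N0 mu0; have ra : root (ehrenfest_P N mu) 0.
  by rewrite /root ehrenfest_PE mul0r.
have o0 := fun i => @root_odd_neq0 _ _ _ _ i mu0 ra.
have e0 := fun i => @root_even_neq0 _ _ _ _ i mu0 ra.
rewrite boundary_resolvent_coef0 // -ehrenfest_QE ehrenfest_R0.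
under [\prod_(r < N) (0 + _)]eq_bigr do rewrite add0r.
rewrite prod_even.
have q0 : 0 < (ehrenfest_Q N mu).[0].
  rewrite ehrenfest_QE; apply: prodr_gt0 => r _; rewrite add0r -natrM natr1.
  by rewrite !mulr_gt0.
set q := _.[0] in q0 *.
have -> : (2 : R) ^+ (2 * N - 2) = 4 ^+ N.-1.
  have -> : (2 * N - 2 = 2 * N.-1)%N by lia.
  by rewrite exprM -[4]/((2 * 2)%:R) natrM -expr2.
have -> : N`! = (N * (N - 1)`!)%N.
  by case: N N0 {ra o0 e0 q q0} => // n _; rewrite factS subn1.
have -> : (4 * mu) ^+ N = 4 * mu * (4 * mu) ^+ (N - 1).
  by rewrite -exprS; congr (_ ^+ _); lia.
have -> : (4 : R) ^+ N = 4 * 4 ^+ N.-1 by rewrite -exprS prednK.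
set f := (N - 1)`!.
have f0 : f%:R != 0 :> R by rewrite pnatr_eq0 -lt0n fact_gt0.
have N0' : N%:R != 0 :> R by rewrite pnatr_eq0 -lt0n.
have p0 : (4 * mu) ^+ (N - 1) != 0 by rewrite expf_neq0 // mulf_neq0 // gt_eqF.
set p := _ ^+ (N - 1) in p0 *.
have s0 : (4 : R) ^+ N.-1 != 0 by rewrite expf_neq0 // pnatr_eq0.
have d0 : q + 4 * mu * p * (N * f)%:R != 0.
  rewrite gt_eqF // ltr_wpDr // !mulr_ge0 // ?exprn_ge0 // ?mulr_ge0 //;
    exact: ltW.
rewrite natrM in d0 *.
by field; rewrite s0 d0 N0' f0 p0 (gt_eqF mu0) (gt_eqF q0).
Qed.

(** The subtracted multiple of (1 + X)^(2N), whose eigenvalue is 2 mu N, solves the homogeneous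
    equation at a = 0, and is 0 at the other roots. *)
Lemma boundary_eigenpoly_eq (R : realType) N (mu a : R) :
  (0 < N)%N -> 0 < mu -> root (ehrenfest_P N mu) a ->
  mu *: ehrenfest_op (2 * N) (boundary_eigenpoly N mu a) =
  (2 * mu * N%:R + a) *: boundary_eigenpoly N mu a
  + (2 * mu * N%:R) *: ('X^(N - 1) - 'X^N).
Proof.
move=> N0 mu0 ra.
have o0 := fun i => @root_odd_neq0 _ _ _ _ i mu0 ra.
have e0 := fun i => @root_even_neq0 _ _ _ _ i mu0 ra.
rewrite /boundary_eigenpoly ehrenfest_opD -scaleNr ehrenfest_opZ.
rewrite ehrenfest_op_krawtchouk // scalerDr boundary_resolvent_eq //; first last.
- by move=> i iN; rewrite -opprD oppr_eq0 e0.
- by move=> i iN; rewrite -opprD oppr_eq0 o0.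
rewrite [in RHS]scalerDr -!addrA; congr (_ + _); rewrite addrC; congr (_ + _).
rewrite !scalerA; congr (_ *: _).
have [->|a0] := eqVneq a 0; first by rewrite natrM; ring.
by rewrite boundary_resolvent_root // oppr0 !(mulr0, mul0r).
Qed.

Lemma krawtchouk_form_eigen (R : realType) N (mu : R) (alpha : 'I_N.+1 -> R)
    m t :
  (0 < N)%N -> 0 < mu -> injective alpha -> alpha ord0 = 0 ->
  (forall k, root (ehrenfest_P N mu) (alpha k)) ->
  krawtchouk_form N mu (fun k => ehrenfest_R N mu (alpha k)) alpha m t =
  \sum_k ehrenfest_R N mu (alpha k) * expR (alpha k * t) *
     (boundary_eigenpoly N mu (alpha k))`_m.
Proof.
move=> N0 mu0 inj alpha0 hroot.
have sw k b : - alpha k - b = - b - alpha k by rewrite addrC.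
rewrite krawtchouk_form_spectral; first last.
- move=> i iN; under eq_bigr do rewrite sw.
  rewrite ehrenfest_R_sum //; last exact: ehrenfest_P_even_neq0.
  have [q0 ->] := ehrenfest_even mu0 iN.
  by rewrite invfM mulrCA divff // mulr1 invrN.
- move=> i iN; under eq_bigr do rewrite sw.
  rewrite ehrenfest_R_sum //; last exact: ehrenfest_P_odd_neq0.
  by rewrite ehrenfest_QE (bigD1 (Ordinal iN)) //= addNr !mul0r.
- by rewrite gt_eqF.
rewrite big_ord_recl [in RHS]big_ord_recl addrA; congr (_ + _); last first.
  apply: eq_bigr => k _; rewrite /boundary_eigenpoly boundary_resolvent_root //.
    by rewrite scale0r subr0.
  by rewrite -alpha0 (inj_eq inj).
(* At the root 0 the correction weighted by R(0) is exactly the stationary term 4^(-N) (1 +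
   X)^(2N). *)
rewrite alpha0 mul0r expR0 mulr1 /boundary_eigenpoly coefB coefZ.
by rewrite -(boundary_resolvent0 N0 mu0); ring.
Qed.

(** * From the hypergeometric formula to the Krawtchouk form *)

(** The odd polynomial is 1 - X times the even one for 2N - 1, so its coefficients are differences
    of consecutive coefficients of the latter. *)
Lemma hyp2F1_krawtchouk_diff (R : realType) N r j : (r <= N)%N -> (j < N)%N ->
  'C(2 * N - 1, N + r)%:R *
    hyp2F1 (- (2 * j%:R)) (- N%:R + r%:R + 1) (- (2 * N%:R) + 1) 2
  - 'C(2 * N - 1, N + r - 1)%:R *
    hyp2F1 (- (2 * j%:R)) (- N%:R + r%:R) (- (2 * N%:R) + 1) 2
  = (krawtchouk_gf R (2 * N) (2 * j + 1))`_(N + r).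
Proof.
move=> rN jN.
have ec : - (2 * N%:R) + 1 = - (2 * N - 1)%:R :> R.
  by rewrite natrB ?natrM; [ring | lia].
have e1 : - N%:R + r%:R + 1 = - (2 * N - 1)%:R + (N + r)%:R :> R.
  by rewrite -ec natrD; ring.
have e2 : - N%:R + r%:R = - (2 * N - 1)%:R + (N + r - 1)%:R :> R.
  by rewrite -ec natrB ?natrD; [ring | lia].
have -> : krawtchouk_gf R (2 * N) (2 * j + 1) =
    (1 - 'X) * krawtchouk_gf R (2 * N - 1) (2 * j).
  rewrite /krawtchouk_gf exprD expr1.
  by have -> : (2 * N - (2 * j + 1) = 2 * N - 1 - 2 * j)%N; [lia | ring].
rewrite mulrBl mul1r coefB coefXM addn_eq0.
have -> : (N == 0)%N = false by apply/eqP; lia.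
rewrite /= ec; congr (_ - _).
  have [h|h] := leqP (N + r) (2 * N - 1).
    by rewrite e1 hyp2F1_krawtchouk //; lia.
  (* Here r = N: the binomial is 0 whatever the value of [hyp2F1], and the coefficient lies beyond
     the degree 2N - 1. *)
  rewrite bin_small // mul0r nth_default //.
  by apply: leq_trans (size_krawtchouk _ _) _; lia.
by rewrite e2 hyp2F1_krawtchouk -?subn1 //; lia.
Qed.

Lemma transientE (R : realType) n (rho alpha : 'I_n -> R) (b t : R) :
  (forall k, alpha k <= 0) ->
  \sum_k rho k * expR (- `|alpha k| * t) / (`|alpha k| - b)
  - expR (- (b * t)) * \sum_k rho k / (`|alpha k| - b) =
  transient rho alpha b t.
Proof.
move=> h; rewrite /transient.
by under eq_bigr do rewrite ler0_norm // opprK;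
   under [X in _ - _ * X]eq_bigr do rewrite ler0_norm //.
Qed.

(** In the formula the series of index 2j goes with the rates of indices 2N - 1 - 2j and 2N - 2j;
    reflecting the Krawtchouk polynomials matches them, and the sign (-1)^(N + r) of the reflection
    is the factor (-1)^(N - r). *)
Lemma hypergeometric_form (R : realType) N n (mu : R) (rho alpha : 'I_n -> R)
    r (t : R) : (0 < N)%N -> (r <= N)%N -> (forall k, alpha k <= 0) ->
    1 / 4 ^+ N * 'C(2 * N, N + r)%:R *
      \sum_(l < N.+1) 'C(N, l)%:R * (- expR (- (4 * mu * t))) ^+ l *
        hyp2F1 (- (2 * l%:R)) (- N%:R + r%:R) (- (2 * N%:R)) 2
  + mu * N%:R / 2 ^+ (2 * N - 2) * (-1) ^+ (N - r) *
      \sum_(j < N) 'C(N - 1, j)%:R * (-1) ^+ (N - 1 - j) *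
        ('C(2 * N - 1, N + r)%:R *
           hyp2F1 (- (2 * j%:R)) (- N%:R + r%:R + 1) (- (2 * N%:R) + 1) 2
         - 'C(2 * N - 1, N + r - 1)%:R *
           hyp2F1 (- (2 * j%:R)) (- N%:R + r%:R) (- (2 * N%:R) + 1) 2) *
        (\sum_k rho k * expR (- `|alpha k| * t) /
             (`|alpha k| - 2 * mu * (2 * N%:R - 1 - 2 * j%:R))
         - expR (- (2 * mu * t * (2 * N%:R - 1 - 2 * j%:R))) *
           \sum_k rho k /
             (`|alpha k| - 2 * mu * (2 * N%:R - 1 - 2 * j%:R)))
  + mu * N%:R / 2 ^+ (2 * N - 2) * (-1) ^+ (N - r) * 'C(2 * N, N + r)%:R *
      \sum_(j < N) 'C(N - 1, j)%:R * (-1) ^+ (N - 1 - j) *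
        hyp2F1 (- (2 * j%:R)) (- N%:R + r%:R) (- (2 * N%:R)) 2 *
        (\sum_k rho k * expR (- `|alpha k| * t) /
             (`|alpha k| - 4 * mu * (N%:R - j%:R))
         - expR (- (4 * mu * t * (N%:R - j%:R))) *
           \sum_k rho k / (`|alpha k| - 4 * mu * (N%:R - j%:R)))
  = krawtchouk_form N mu rho alpha (N + r) t.
Proof.
move=> N0 rN al0; rewrite /krawtchouk_form -addrA; congr (_ + _).
  rewrite mul1r -mulrA; congr (_ * _); rewrite mulr_sumr; apply: eq_bigr => l _.
  have hl := ltn_ord l.
  rewrite -hyp2F1_krawtchouk; [|lia..].
  have -> : - (2 * N)%:R + (N + r)%:R = - N%:R + r%:R :> R.
    by rewrite natrM natrD; ring.
  by rewrite natrM; ring.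
have sgn : (-1) ^+ (N - r) = (-1) ^+ (N + r) :> R.
  by rewrite -signr_odd oddB // -oddD signr_odd.
rewrite sgn !mulr_sumr -big_split /=.
rewrite (reindex_inj rev_ord_inj); apply: eq_bigr => i _ /=.
have iN := ltn_ord i; set j := (N - i.+1)%N.
have jN : (j < N)%N by rewrite /j; lia.
have ej : j%:R = N%:R - i%:R - 1 :> R.
  by rewrite /j natrB // -natr1; ring.
rewrite hyp2F1_krawtchouk_diff //.
have -> : 2 * mu * (2 * N%:R - 1 - 2 * j%:R) = 2 * mu * (2 * i%:R + 1).
  by rewrite ej; ring.
have -> : 4 * mu * (N%:R - j%:R) = 2 * mu * (2 * i%:R + 2) by rewrite ej; ring.
have -> : 2 * mu * t * (2 * N%:R - 1 - 2 * j%:R) = 2 * mu * (2 * i%:R + 1) * t.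
  by rewrite ej; ring.
have -> : 4 * mu * t * (N%:R - j%:R) = 2 * mu * (2 * i%:R + 2) * t.
  by rewrite ej; ring.
rewrite !transientE //.
have -> : (2 * i + 1 = 2 * N - (2 * j + 1))%N by rewrite /j; lia.
have -> : (2 * i + 2 = 2 * N - 2 * j)%N by rewrite /j; lia.
rewrite !krawtchouk_reflect; [|lia..].
rewrite -(@hyp2F1_krawtchouk _ _ _ j); [|lia..].
have -> : - (2 * N)%:R + (N + r)%:R = - N%:R + r%:R :> R.
  by rewrite natrM natrD; ring.
rewrite /boundary_weight.
have -> : 'C(N - 1, i) = 'C(N - 1, j).
  rewrite -[RHS]bin_sub; last by lia.
  by congr ('C(_, _)); rewrite /j; lia.
have -> : (N - 1 - j = i)%N by rewrite /j; lia.
by rewrite natrM; ring.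
Qed.

(** * Lumping to the number of particles *)

(** Over plain naturals, with no separate case for i = N: the upward rate mu (N - i) vanishes
    there. *)
Definition number_gen (R : pzRingType) N (mu : R) (i j : nat) : R :=
  if i == 0 then (j == 1%N)%:R * (mu * N%:R) - (j == 0%N)%:R * (mu * N%:R)
  else (j.+1 == i)%:R * (mu * (N%:R + i%:R))
     + (j == i.+1)%:R * (mu * (N%:R - i%:R)) - (j == i)%:R * (2 * mu * N%:R).

Lemma sum_ord_pick (R : pzRingType) n c (F : nat -> R) :
  \sum_(j < n) (j == c :> nat)%:R * F j = (c < n)%N%:R * F c.
Proof.
have [cn|cn] := ltnP c n.
  rewrite (bigD1 (Ordinal cn)) //= eqxx big1 ?addr0 // => j jc.
  rewrite (_ : (j == c :> nat) = false) ?mul0r //.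
  by apply: contraNF jc => /eqP e; apply/eqP; apply: val_inj.
rewrite mul0r big1 // => j _; have := ltn_ord j => hj.
by rewrite (_ : (j == c :> nat) = false) ?mul0r //; apply/eqP; lia.
Qed.

Lemma number_gen0 (R : comPzRingType) N (mu : R) i :
  number_gen N mu i 0 = (i == 1%N)%:R * (mu * (N%:R + 1))
    + (i == 0%N)%:R * (- (mu * N%:R)).
Proof.
by rewrite /number_gen; case: i => [|[|i]] /=;
  rewrite ?mulr0n ?mulr1n ?mul0r ?mul1r ?subr0 ?addr0.
Qed.

Lemma number_genS (R : comPzRingType) N (mu : R) i r :
  number_gen N mu i r.+1 = (i == r)%:R * (mu * (N%:R - r%:R))
    + (i == r.+2)%:R * (mu * (N%:R + r.+2%:R))
    - (i == r.+1)%:R * (2 * mu * N%:R).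
Proof.
have sw c (F : nat -> R) : (i == c)%:R * F c = (i == c)%:R * F i.
  by case: eqP => [->|]; rewrite ?mul0r.
rewrite (sw r (fun k => mu * (N%:R - k%:R))).
rewrite (sw r.+2 (fun k => mu * (N%:R + k%:R))).
rewrite /number_gen !eqSS [r.+2 == i]eq_sym [r == i]eq_sym [r.+1 == i]eq_sym.
case: i sw => [|i] _ /=; last by rewrite [X in X - _]addrC.
by rewrite !mul0r !subr0 addr0 ?[r == 0%N]eq_sym.
Qed.

(** The recursions are the columns of the left eigenvector equation, and [v N.+1 = 0] stands for the
    missing state above N. *)
Lemma number_gen_eigen (R : numFieldType) N (mu a : R) (v : nat -> R) :
  (0 < N)%N -> v N.+1 = 0 ->
  a * v 0%N = mu * (N%:R + 1) * v 1%N - mu * N%:R * v 0%N ->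
  (forall r, a * v r.+1 = mu * (N%:R - r%:R) * v r
    + mu * (N%:R + r.+2%:R) * v r.+2 - 2 * mu * N%:R * v r.+1) ->
  forall j, (j <= N)%N -> \sum_(i < N.+1) v i * number_gen N mu i j = a * v j.
Proof.
move=> N0 vN v0 vS [|r] rN.
  rewrite v0 (eq_bigr (fun i : 'I_N.+1 =>
     (i == 1%N :> nat)%:R * (mu * (N%:R + 1) * v i)
     + (i == 0%N :> nat)%:R * (- (mu * N%:R) * v i))); last first.
    by move=> i _; rewrite number_gen0; ring.
  rewrite big_split /= (sum_ord_pick _ _ (fun i => mu * (N%:R + 1) * v i)).
  rewrite (sum_ord_pick _ _ (fun i => - (mu * N%:R) * v i)) ltnS N0 /=; ring.
rewrite vS (eq_bigr (fun i : 'I_N.+1 =>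
     (i == r :> nat)%:R * (mu * (N%:R - r%:R) * v i)
     + (i == r.+2 :> nat)%:R * (mu * (N%:R + r.+2%:R) * v i)
     - (i == r.+1 :> nat)%:R * (2 * mu * N%:R * v i))); last first.
  by move=> i _; rewrite number_genS; ring.
rewrite sumrB big_split /=.
rewrite (sum_ord_pick _ _ (fun i => mu * (N%:R - r%:R) * v i)).
rewrite (sum_ord_pick _ _ (fun i => mu * (N%:R + r.+2%:R) * v i)).
rewrite (sum_ord_pick _ _ (fun i => 2 * mu * N%:R * v i)).
have -> : (r < N.+1)%N by lia.
have -> : (r.+1 < N.+1)%N by lia.
rewrite ltnS; case: ltnP => h /=; first by rewrite !mul1r.
have -> : r.+2 = N.+1 by lia.
by rewrite vN !mulr0 !mul1r.
Qed.

Lemma generatorE (R : realType) (S : finType) (rate : S -> S -> R) x y :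
  rate x x = 0 ->
  generator rate x y = rate x y - (x == y)%:R * \sum_z rate x z.
Proof.
move=> r0; rewrite /generator [in RHS](bigD1 x) //= r0 add0r.
by case: eqVneq => [<-|_]; rewrite ?r0 ?mul1r ?mul0r ?sub0r ?subr0.
Qed.

(** The rows of C sum to 1, which makes the rate from an empty state to level 1 independent of its
    type; from a nonempty state only the type l contributes. *)
Lemma ehrenfest_rate_sum (R : realType) N d (mu : R) (C : 'M[R]_d)
    (i j : 'I_N.+1) l :
  stochastic C ->
  \sum_j' ehrenfest_rate mu mu C (i, l) (j, j') =
  if i == 0%N :> nat then (j == 1%N :> nat)%:R * (mu * N%:R)
  else (j.+1 == i :> nat)%:R * (mu * (N%:R + i%:R))
     + (j == i.+1 :> nat)%:R * (mu * (N%:R - i%:R)).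
Proof.
move=> [_ sC]; rewrite /ehrenfest_rate; case: (i == 0%N :> nat).
  case: (j == 1%N :> nat); last by rewrite mul0r big1.
  by under eq_bigr do rewrite -mulrA; rewrite -mulr_suml sC.
rewrite (bigD1 l) //= eqxx /= big1 ?addr0; last by move=> k /negbTE ->.
case: ifP => h1.
  have -> : (j == i.+1 :> nat) = false by apply/eqP; move/eqP: h1; lia.
  by rewrite mul1r mul0r addr0.
by rewrite mul0r add0r; case: ifP; rewrite ?mul1r ?mul0r.
Qed.

Lemma ehrenfest_rate_total (R : realType) N d (mu : R) (C : 'M[R]_d)
    (i : 'I_N.+1) l : (0 < N)%N -> stochastic C ->
  \sum_z ehrenfest_rate mu mu C (i, l) z =
  if i == 0%N :> nat then mu * N%:R else 2 * mu * N%:R.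
Proof.
move=> N0 sC.
have -> : \sum_z ehrenfest_rate mu mu C (i, l) z =
    \sum_j \sum_k ehrenfest_rate mu mu C (i, l) (j, k).
  by rewrite pair_bigA; apply: eq_bigr => -[].
under eq_bigr do rewrite ehrenfest_rate_sum //.
case: ifP => i0.
  by rewrite (sum_ord_pick N.+1 1 (fun=> mu * N%:R)) ltnS N0 mul1r.
rewrite big_split /= (sum_ord_pick N.+1 i.+1 (fun=> mu * (N%:R - i%:R))).
case: i i0 => -[//|i] hi _ /=; under eq_bigr do rewrite eqSS.
rewrite (sum_ord_pick N.+1 i (fun=> mu * (N%:R + i.+1%:R))).
have -> : (i < N.+1)%N by lia.
rewrite ltnS; case: ltnP => h; first by rewrite !mul1r; ring.
have -> : i.+1 = N by lia.
rewrite mul1r mul0r; ring.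
Qed.

(** Lumpability: the sum does not depend on l, so the number of particles obeys a closed forward
    equation. *)
Lemma generator_lump (R : realType) N d (mu : R) (C : 'M[R]_d)
    (i : 'I_N.+1) l (j : 'I_N.+1) : (0 < N)%N -> stochastic C ->
  \sum_j' generator (ehrenfest_rate mu mu C) (i, l) (j, j') =
  number_gen N mu i j.
Proof.
move=> N0 sC.
have r0 : ehrenfest_rate mu mu C (i, l) (i, l) = 0.
  rewrite /ehrenfest_rate eqxx /=; case: ifP => [/eqP -> //|_].
  rewrite -[X in if X then _ else _]/(i.+1 == i)%N.
  by repeat (case: ifP => [/eqP|_]; [lia|]).
under eq_bigr do rewrite generatorE //.
rewrite sumrB ehrenfest_rate_sum // -mulr_suml ehrenfest_rate_total //.
have -> : \sum_(j' < d) ((i, l) == (j, j'))%:R = (j == i :> nat)%:R :> R.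
  rewrite (bigD1 l) //= xpair_eqE eqxx andbT eq_sym big1 ?addr0 //.
  by move=> k kl; rewrite xpair_eqE [l == k]eq_sym (negbTE kl) andbF.
rewrite /number_gen; case: ifP => i0 //.
by rewrite (eqP i0).
Qed.

(** * Kolmogorov's forward equation *)

Lemma cvg_sum (R : realType) (T : Type) (F : set_system T) (I : finType)
    (f : I -> T -> R) (l : I -> R) : Filter F ->
  (forall i, f i x @[x --> F] --> l i) ->
  \sum_i f i x @[x --> F] --> \sum_i l i.
Proof.
move=> FF h; apply: cvg_big => //; exact: (@add_continuous R).
Qed.

Lemma is_derive_right_left (R : realType) (f : R -> R) (t d : R) :
  (f (t + h) - f t) / h @[h --> 0^'+] --> d ->
  (f (t - h) - f t) / - h @[h --> 0^'+] --> d ->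
  is_derive t 1 f d.
Proof.
move=> hr hl.
have c : h^-1 *: ((f \o shift t) (h *: 1) - f t) @[h --> 0^'] --> d.
  apply/(@cvg_at_right_left_dnbhs _ R^o).
    apply: cvg_trans hr; apply: near_eq_cvg; near=> h.
    by rewrite /= -[h *: 1]/(h * 1) mulr1 [h + t]addrC mulrC.
  apply/cvg_at_leftNP; rewrite oppr0.
  apply: cvg_trans hl; apply: near_eq_cvg; near=> h.
  by rewrite /= -[- h *: 1]/(- h * 1) mulr1 [- h + t]addrC mulrC.
by apply: DeriveDef; [apply/cvg_ex; exists d | exact/cvg_lim].
Unshelve. all: by end_near. Qed.

Lemma transition_cvg0 (R : realType) (S : finType) (rate : S -> S -> R)
    (Pt : R -> S -> S -> R) x y :
  (Pt h x y - (x == y)%:R) / h @[h --> 0^'+] --> generator rate x y ->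
  Pt h x y @[h --> 0^'+] --> ((x == y)%:R : R).
Proof.
move=> hG.
have h0 : (h : R) @[h --> 0^'+] --> (0 : R).
  exact: (@cvg_at_right_filter R R id 0 0 cvg_id).
have c1 : ((x == y)%:R : R) @[_ --> (0 : R)^'+] --> ((x == y)%:R : R).
  exact: cvg_cst.
have hc : (x == y)%:R + h * ((Pt h x y - (x == y)%:R) / h) @[h --> 0^'+] -->
    (x == y)%:R + 0 * generator rate x y.
  by apply: cvgD; [exact: c1 | apply: cvgM].
rewrite mul0r addr0 in hc.
apply: cvg_trans hc; apply: near_eq_cvg; near=> h.
have hh : h != 0 by rewrite gt_eqF.
by rewrite /= mulrC divfK // addrC subrK.
Unshelve. all: by end_near. Qed.

Lemma transition_le1 (R : realType) (S : finType) (Pt : R -> S -> S -> R)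
    t x y :
  transition_function Pt -> 0 <= t -> Pt t x y <= 1.
Proof.
case=> ge0 sum1 _ _ t0; rewrite -(sum1 t x t0) (bigD1 y) //= lerDl.
by apply: sumr_ge0 => z _; exact: ge0.
Qed.

(* The left difference quotient at [t] is that of the semigroup at [0]
   multiplied by [Pt (t - h)], hence the need for left continuity. *)
Lemma kolmogorov_forward (R : realType) (S : finType) (rate : S -> S -> R)
    (Pt : R -> S -> S -> R) :
  transition_function Pt ->
  (forall x y, (Pt h x y - (x == y)%:R) / h @[h --> 0^'+]
     --> generator rate x y) ->
  forall (t : R) x y, 0 < t ->
  is_derive t 1 (fun s => Pt s x y) (\sum_z Pt t x z * generator rate z y).
Proof.
move=> tP hG t x y t0; have [ge0 sum1 P0 add] := tP.
have c0 z w := transition_cvg0 (hG z w).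
have dE s z w h : 0 <= s -> 0 <= h ->
    Pt (s + h) z w - Pt s z w = \sum_u Pt s z u * (Pt h u w - (u == w)%:R).
  move=> s0 h0; rewrite add //.
  under [RHS]eq_bigr do rewrite mulrBr.
  rewrite sumrB; congr (_ - _).
  rewrite (bigD1 w) //= eqxx mulr1 big1 ?addr0 // => u /negbTE ->.
  by rewrite mulr0.
(* The entries of [Pt (t - h)] lie in [0, 1], so the increment over h is at most the sum of |Pt h u
   z - (u == z)| over u, which tends to 0. *)
have lc z : Pt (t - h) x z @[h --> 0^'+] --> Pt t x z.
  have b : \sum_u `|Pt h u z - (u == z)%:R| @[h --> 0^'+] -->
      \sum_(u : S) (0 : R).
    apply: cvg_sum => u; rewrite -[X in _ --> X](normr0 R); apply: cvg_norm.
    rewrite -[X in _ --> X](subrr ((u == z)%:R : R)).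
    by apply: cvgB; [exact: c0 | exact: cvg_cst].
  rewrite big1 // in b.
  apply/cvgrPdist_le => e e0; move/cvgrPdist_le : b => /(_ e e0) b.
  near=> h.
  have h0 : 0 <= h by [].
  have ht : 0 <= t - h by rewrite subr_ge0; near: h; exact: nbhs_right_le.
  have : `|0 - \sum_u `|Pt h u z - (u == z)%:R| | <= e by near: h.
  rewrite sub0r normrN; apply: le_trans.
  rewrite [X in _ <= X]ger0_norm; last by apply: sumr_ge0.
  rewrite -{1}[t](subrK h) dE //; apply: le_trans (ler_norm_sum _ _ _) _.
  apply: ler_sum => u _; rewrite normrM ler_piMl //.
  by rewrite ger0_norm ?ge0 // transition_le1.
apply: is_derive_right_left.
  have hc : \sum_z Pt t x z * ((Pt h z y - (z == y)%:R) / h) @[h --> 0^'+] -->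
      \sum_z Pt t x z * generator rate z y.
    by apply: cvg_sum => z; apply: cvgMl_tmp; exact: hG.
  apply: cvg_trans hc; apply: near_eq_cvg; near=> h.
  have h0 : 0 <= h by [].
  rewrite dE //; last exact: ltW.
  by rewrite mulr_suml; apply: eq_bigr => z _; rewrite mulrA.
have hc : \sum_z Pt (t - h) x z * ((Pt h z y - (z == y)%:R) / h)
    @[h --> 0^'+] --> \sum_z Pt t x z * generator rate z y.
  by apply: cvg_sum => z; apply: cvgM; [exact: lc | exact: hG].
apply: cvg_trans hc; apply: near_eq_cvg; near=> h.
have h0 : 0 <= h by [].
have ht : 0 <= t - h by rewrite subr_ge0; near: h; exact: nbhs_right_le.
rewrite -[in X in _ = (_ - X) / _](subrK h t) invrN mulrN -mulNr opprB dE //.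
by rewrite mulr_suml; apply: eq_bigr => z _; rewrite mulrA.
Unshelve. all: by end_near. Qed.

(** * Uniqueness for linear differential systems *)

(** Gronwall's argument: the energy q = sum_j w_j^2 satisfies q' <= K q, so exp(- K t) q is
    nonincreasing from 0. Right continuity at 0 links the initial value to the equation, which is
    given for t > 0 only. *)
Lemma linear_ode_unique (R : realType) n (g : 'I_n -> 'I_n -> R)
    (w : 'I_n -> R -> R) :
  (forall j, w j 0 = 0) -> (forall j, w j s @[s --> 0^'+] --> (0 : R)) ->
  (forall j (t : R), 0 < t -> is_derive t 1 (w j) (\sum_i w i t * g i j)) ->
  forall j (t : R), 0 <= t -> w j t = 0.
Proof.
move=> w0 wc wd.
pose M : R := \sum_i \sum_j `|g i j|.
have gM i j : `|g i j| <= M.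
  rewrite /M (bigD1 i) //= (bigD1 j) //= -addrA lerDl.
  rewrite addr_ge0 // sumr_ge0 // => k _.
  by rewrite sumr_ge0.
pose K : R := 2 * n%:R * M.
pose q (s : R) := \sum_j w j s ^+ 2.
pose dq (s : R) := \sum_j 2 * w j s * \sum_i w i s * g i j.
have q0 s : 0 <= q s by apply: sumr_ge0 => j _; exact: sqr_ge0.
(* The bound 2 |w_i w_j| <= w_i^2 + w_j^2, summed over both indices, gives the factor 2 n of K. *)
have dqK s : dq s <= K * q s.
  have -> : K * q s = \sum_j \sum_i M * (w i s ^+ 2 + w j s ^+ 2).
    under eq_bigr do rewrite -mulr_sumr big_split /= sumr_const card_ord -/(q s)
      -[_ *+ n]mulr_natl.
    rewrite -mulr_sumr big_split /= sumr_const card_ord -mulr_sumr -/(q s).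
    by rewrite -[_ *+ n]mulr_natl /K; ring.
  apply: ler_sum => j _; rewrite mulr_sumr; apply: ler_sum => i _.
  apply: le_trans (ler_norm _) _; rewrite !normrM ger0_norm //.
  apply: (@le_trans _ _ (2 * `|w j s| * `|w i s| * M)).
    by rewrite -!mulrA !ler_wpM2l.
  rewrite mulrC ler_wpM2l //; first by apply: le_trans (gM i j).
  rewrite -[w i s ^+ 2]real_normK ?num_real //.
  rewrite -[w j s ^+ 2]real_normK ?num_real //.
  by have := sqr_ge0 (`|w i s| - `|w j s|); rewrite sqrrB; lra.
have qd (t : R) : 0 < t -> is_derive t 1 q (dq t).
  move=> t0; have -> : q = \sum_(j < n) (w j) ^+ 2.
    apply/funext => s; rewrite fct_sumE.
    by apply: eq_bigr => j _; rewrite exprfctE.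
  have h j := is_deriveX 2 (wd j t t0).
  apply: is_derive_eq; apply: eq_bigr => j _.
  by rewrite expr1.
pose f (s : R) := expR (- (K * s)) * q s.
have fd (t : R) : 0 < t ->
    is_derive t 1 f (expR (- (K * t)) * (dq t - K * q t)).
  move=> t0; have dq' := qd t t0.
  have de : is_derive t 1 (fun s => expR (- (K * s))) (expR (- (K * t)) * - K).
    have dl : is_derive t 1 (fun s : R => - (K * s)) (- K).
      rewrite (_ : (fun s => - (K * s)) = (- K) *: id); last first.
        by apply/funext => s /=; rewrite -mulNr.
      by apply: is_derive_eq; rewrite -[LHS]/(- K * 1) mulr1.
    exact: is_derive1_comp.
  rewrite (_ : f = (fun s => expR (- (K * s))) * q) //.
  apply: is_derive_eq.
  rewrite -[_ *: dq t]/(_ * _) -[q t *: _]/(_ * _); ring.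
have fc : {within `[0, +oo[, continuous f}.
  apply/continuous_within_itvcyP; split.
    move=> s; rewrite in_itv /= andbT => s0.
    have [ds _] := fd s s0.
    exact/differentiable_continuous/derivable1_diffP.
  have f0 : f 0 = 0 by rewrite /f /q big1 ?mulr0 // => j _; rewrite w0 expr0n.
  rewrite f0.
  have hc : expR (- (K * s)) * q s @[s --> 0^'+] -->
      expR (- (K * 0)) * \sum_(j < n) (0 * 0 : R).
    apply: cvgM.
      apply: cvg_at_right_filter.
      apply: continuous_comp; last exact: continuous_expR.
      by apply: continuousN; apply: continuousM => //; exact: cst_continuous.
    rewrite /q; under eq_fun do under eq_bigr do rewrite expr2.
    by apply: cvg_sum => j; apply: cvgM; exact: wc.
  by move: hc; rewrite big1 ?mulr0 // => j _; rewrite mulr0.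
move=> j t t0.
have f0 : f 0 = 0 by rewrite /f /q big1 ?mulr0 // => i _; rewrite w0 expr0n.
have fdv (s : R) : s \in `]0, +oo[%R -> derivable f s 1.
  by rewrite in_itv /= andbT => s0; have [] := fd s s0.
have fle (s : R) : s \in `]0, +oo[%R -> f^`()%classic s <= 0.
  rewrite in_itv /= andbT => s0.
  rewrite derive1E (@derive_val _ _ _ _ _ _ _ (fd s s0)).
  by rewrite mulr_ge0_le0 ?expR_ge0 // subr_le0.
have ft : f t <= f 0 := ler0_derive1_nincry fdv fle fc (lexx 0) t0.
rewrite f0 /f pmulr_rle0 ?expR_gt0 // in ft.
have qt : q t = 0 by apply/eqP; rewrite eq_le ft q0.
move/eqP: qt; rewrite psumr_eq0; last by move=> i _; exact: sqr_ge0.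
by move=> /allP /(_ j (mem_index_enum _)); rewrite sqrf_eq0 => /eqP.
Qed.

(** * The law of the number of particles *)

Lemma probability_setI_full (R : realType) (disp : measure_display)
    (T : measurableType disp) (Pr : probability T R) (A B : set T) :
  measurable A -> measurable B -> Pr A = 1%E -> Pr (A `&` B) = Pr B.
Proof.
move=> mA mB A1.
have C0 : Pr (~` A) = 0%E by rewrite probability_setC // A1 subee.
rewrite -[in RHS](setIT B) -(setvU A) setIUr measureU; last 3 first.
- by apply: measurableI => //; exact: measurableC.
- exact: measurableI.
- by rewrite setIACA setICl setI0.
rewrite [X in (X + _)%E](_ : _ = 0%E) ?add0e 1?setIC //.
apply/eqP; rewrite eq_le measure_ge0 andbT -C0 le_measure //.
- by rewrite inE; apply: measurableI => //; exact: measurableC.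
- by rewrite inE; exact: measurableC.
Qed.

(** The Markov property is applied with the empty past at s = 0, where the event of starting in [x0]
    has probability 1. *)
Lemma markov_chain_law (R : realType) (disp : measure_display)
    (T : measurableType disp) (Pr : probability T R) (S : finType)
    (rate : S -> S -> R) (x0 : S) (X : R -> T -> S) :
  markov_chain Pr rate x0 X ->
  exists Pt : R -> S -> S -> R,
    [/\ transition_function Pt,
        forall x y, (Pt h x y - (x == y)%:R) / h @[h --> 0^'+]
                      --> generator rate x y
      & forall t y, 0 <= t -> Pr [set w | X t w = y] = (Pt t x0 y)%:E].
Proof.
move=> [mX P0 [Pt [tP hG mk]]]; exists Pt; split=> // t y t0.
have := mk [::] 0 t x0 y (lexx 0) t0; rewrite add0r /=.
have -> : [set w | forall e : R * S, e \in [::] -> X e.1 w = e.2] = setT.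
  by apply/seteqP; split=> w.
rewrite setTI P0 mul1e probability_setI_full //; try exact: mX.
by apply.
Qed.

Lemma is_derive_exp_sum (R : realType) n (c a : 'I_n -> R) (t : R) :
  is_derive t 1 (fun s => \sum_k c k * expR (a k * s))
    (\sum_k a k * (c k * expR (a k * t))).
Proof.
have -> : (fun s => \sum_k c k * expR (a k * s)) =
    \sum_(k < n) (fun s => c k * expR (a k * s)).
  by apply/funext => s; rewrite fct_sumE.
have h k : is_derive t 1 (fun s => c k * expR (a k * s))
    (a k * (c k * expR (a k * t))).
  have dl : is_derive t 1 (fun s : R => a k * s) (a k).
    rewrite (_ : (fun s => a k * s) = a k *: id) //.
    by apply: is_derive_eq; rewrite -[LHS]/(a k * 1) mulr1.
  have de : is_derive t 1 (fun s => expR (a k * s)) (expR (a k * t) * a k).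
    exact: is_derive1_comp.
  rewrite (_ : (fun s => _) = c k *: (fun s => expR (a k * s))) //.
  by apply: is_derive_eq; rewrite -[LHS]/(c k * _); ring.
exact: is_derive_sum.
Qed.

(** Both sides solve the forward equation of [number_gen] with all mass at 0 initially, so
    [linear_ode_unique] applies to their difference. *)
Lemma number_law_spectral (R : realType) (N d : nat) (mu : R) (C : 'M[R]_d)
    (l0 : 'I_d) (Pt : R -> 'I_N.+1 * 'I_d -> 'I_N.+1 * 'I_d -> R)
    (alpha : 'I_N.+1 -> R) (t : R) (r : 'I_N.+1) :
  (0 < N)%N -> 0 < mu -> stochastic C -> transition_function Pt ->
  (forall x y, (Pt h x y - (x == y)%:R) / h @[h --> 0^'+]
                      --> generator (ehrenfest_rate mu mu C) x y) ->
  injective alpha -> alpha ord0 = 0 ->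
  (forall k, root (ehrenfest_P N mu) (alpha k)) -> 0 <= t ->
  \sum_j Pt t (ord0, l0) (r, j) =
  \sum_k ehrenfest_R N mu (alpha k) * expR (alpha k * t) *
     (boundary_eigenpoly N mu (alpha k))`_(N + r).
Proof.
move=> N0 mu0 sC tP hG inj al0 hroot t0.
have [_ _ P0 _] := tP.
pose E k i := (boundary_eigenpoly N mu (alpha k))`_(N + i).
pose c k i := ehrenfest_R N mu (alpha k) * E k i.
pose p (j : 'I_N.+1) s := \sum_j' Pt s (ord0, l0) (j, j').
pose q (j : 'I_N.+1) s := \sum_k c k j * expR (alpha k * s).
have qE j s : q j s = \sum_k ehrenfest_R N mu (alpha k) * expR (alpha k * s) *
     (boundary_eigenpoly N mu (alpha k))`_(N + j).
  by apply: eq_bigr => k _; rewrite /c /E; ring.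
suff : p r t - q r t = 0 by move/eqP; rewrite subr_eq0 => /eqP; rewrite qE.
have p0 j : p j 0 = (j == ord0)%:R.
  rewrite /p; under eq_bigr do rewrite P0 xpair_eqE.
  rewrite (bigD1 l0) //= eqxx andbT eq_sym big1 ?addr0 // => k kl.
  by rewrite [l0 == k]eq_sym (negbTE kl) andbF.
(* The initial value of the spectral sum is read off the equal [krawtchouk_form], without inverting
   the eigenvector matrix. *)
have q0 j : q j 0 = (j == ord0)%:R.
  rewrite qE -krawtchouk_form_eigen // krawtchouk_form0 -[X in _ == X]addn0.
  by rewrite eqn_add2l.
apply: (@linear_ode_unique _ _ (fun i j => number_gen N mu i j)
  (fun j s => p j s - q j s)) => //.
- by move=> j; rewrite p0 q0 subrr.
- move=> j; rewrite -[X in _ --> X](subrr ((j == ord0)%:R : R)).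
  apply: cvgB.
    rewrite -p0 /p; apply: cvg_sum => k; rewrite P0.
    exact: (transition_cvg0 (hG _ _)).
  rewrite -q0; apply: cvg_at_right_filter.
  have [dq _] := is_derive_exp_sum (c^~ j) alpha 0.
  exact/differentiable_continuous/derivable1_diffP.
move=> j s s0.
have dp : is_derive s 1 (p j) (\sum_i p i s * number_gen N mu i j).
  have -> : p j = \sum_(j' < d) (fun s => Pt s (ord0, l0) (j, j')).
    by apply/funext => u; rewrite fct_sumE.
  have h j' := kolmogorov_forward tP hG (ord0, l0) (j, j') s0.
  apply: is_derive_eq; rewrite exchange_big /=.
  transitivity (\sum_i \sum_l Pt s (ord0, l0) (i, l) * number_gen N mu i j).
    rewrite [in RHS]pair_bigA; apply: eq_bigr => -[i l] _ /=.
    by rewrite -mulr_sumr generator_lump.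
  by apply: eq_bigr => i _; rewrite -mulr_suml.
have dq := is_derive_exp_sum (c^~ j) alpha s.
rewrite (_ : (fun s => _) = p j - q j) //.
apply: is_derive_eq; under [RHS]eq_bigr do rewrite mulrBl.
rewrite sumrB; congr (_ - _).
under [RHS]eq_bigr do rewrite mulr_suml; rewrite exchange_big /=.
apply: eq_bigr => k _.
have ck : \sum_(i < N.+1) c k i * number_gen N mu i j = alpha k * c k j.
  have [e0 eS] := boundary_eigen N0 (lt0r_neq0 mu0)
    (boundary_eigenpoly_coef0 N mu (alpha k))
    (boundary_eigenpoly_eq N0 mu0 (hroot k)).
  apply: (number_gen_eigen N0).
  (* The index N + 1 is the degree 2N + 1, beyond the degree of the polynomial. *)
  - rewrite /c /E nth_default ?mulr0 //.
    by apply: leq_trans (size_boundary_eigenpoly _ _ _) _; lia.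
  - by rewrite /c /E addn0 addn1 mulrCA e0; ring.
  - by move=> i; rewrite /c /E mulrCA eS; ring.
  - by rewrite -ltnS.
rewrite mulrA -ck mulr_suml; apply: eq_bigr => i _; ring.
Qed.

Lemma decreasing_injective (R : realType) n (alpha : 'I_n -> R) :
  (forall i j : 'I_n, (i < j)%N -> alpha j < alpha i) -> injective alpha.
Proof.
move=> decr i j ij; case: (ltngtP i j) => [h|h|/val_inj //].
  by have := decr _ _ h; rewrite ij ltxx.
by have := decr _ _ h; rewrite ij ltxx.
Qed.

Unset Implicit Arguments.
Set Strict Implicit.

Theorem proposition3p5 (R : realType) (N d : nat) (lambda mu : R)
    (C : 'M[R]_d) (l0 : 'I_d)
    (disp : measure_display) (T : measurableType disp) (Pr : probability T R)
    (X : R -> T -> 'I_N.+1 * 'I_d) (alpha : 'I_N.+1 -> R)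
    (mu_gt0 : 0 < mu) (lambda_mu : lambda = mu)
    (C_stochastic : stochastic C)
    (X_chain : markov_chain Pr (ehrenfest_rate lambda mu C) (ord0, l0) X)
    (alpha0 : alpha ord0 = 0)
    (alpha_decr : forall i j : 'I_N.+1, (i < j)%N -> alpha j < alpha i)
    (alpha_roots : forall x : R,
       root (ehrenfest_P N mu) x <-> exists k : 'I_N.+1, x = alpha k)
    (t : R) (t_ge0 : 0 <= t) (r : 'I_N.+1) (r_ge1 : (1 <= r)%N) :
  number_prob Pr X r t =
    1 / 4 ^+ N * 'C(2 * N, N + r)%:R *
      \sum_(l < N.+1) 'C(N, l)%:R * (- expR (- (4 * mu * t))) ^+ l *
        hyp2F1 (- (2 * l%:R)) (- N%:R + r%:R) (- (2 * N%:R)) 2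
  + mu * N%:R / 2 ^+ (2 * N - 2) * (-1) ^+ (N - r) *
      \sum_(j < N) 'C(N - 1, j)%:R * (-1) ^+ (N - 1 - j) *
        ('C(2 * N - 1, N + r)%:R *
           hyp2F1 (- (2 * j%:R)) (- N%:R + r%:R + 1) (- (2 * N%:R) + 1) 2
         - 'C(2 * N - 1, N + r - 1)%:R *
           hyp2F1 (- (2 * j%:R)) (- N%:R + r%:R) (- (2 * N%:R) + 1) 2) *
        (\sum_(k < N.+1) ehrenfest_R N mu (alpha k) * expR (- `|alpha k| * t) /
             (`|alpha k| - 2 * mu * (2 * N%:R - 1 - 2 * j%:R))
         - expR (- (2 * mu * t * (2 * N%:R - 1 - 2 * j%:R))) *
           \sum_(k < N.+1) ehrenfest_R N mu (alpha k) /
             (`|alpha k| - 2 * mu * (2 * N%:R - 1 - 2 * j%:R)))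
  + mu * N%:R / 2 ^+ (2 * N - 2) * (-1) ^+ (N - r) * 'C(2 * N, N + r)%:R *
      \sum_(j < N) 'C(N - 1, j)%:R * (-1) ^+ (N - 1 - j) *
        hyp2F1 (- (2 * j%:R)) (- N%:R + r%:R) (- (2 * N%:R)) 2 *
        (\sum_(k < N.+1) ehrenfest_R N mu (alpha k) * expR (- `|alpha k| * t) /
             (`|alpha k| - 4 * mu * (N%:R - j%:R))
         - expR (- (4 * mu * t * (N%:R - j%:R))) *
           \sum_(k < N.+1) ehrenfest_R N mu (alpha k) /
             (`|alpha k| - 4 * mu * (N%:R - j%:R))).
Proof.
have N0 : (0 < N)%N by exact: leq_trans r_ge1 (ltn_ord r : (r <= N)%N).
have inj := decreasing_injective alpha_decr.
have hroot k : root (ehrenfest_P N mu) (alpha k) by apply/alpha_roots; exists k.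
(* The roots decrease from 0, so the absolute values in the formula are the opposites of the
   roots. *)
have al0 k : alpha k <= 0.
  have [->|k0] := eqVneq k ord0; first by rewrite alpha0.
  by rewrite -alpha0 ltW // alpha_decr // lt0n.
rewrite lambda_mu in X_chain.
have [Pt [tP hG law]] := markov_chain_law X_chain.
pose rho k := ehrenfest_R N mu (alpha k).
have rN : (r <= N)%N by rewrite -ltnS.
have form := hypergeometric_form mu rho t N0 rN al0.
symmetry; apply: (etrans form).
rewrite krawtchouk_form_eigen // -(number_law_spectral l0 r N0 mu_gt0
  C_stochastic tP hG inj alpha0 hroot t_ge0).
by apply: eq_bigr => j _; rewrite /state_prob law.
Qed.
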